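(* Let $n\ge2$ even, $\alpha\in\mathbb{N}$, $\beta>\frac{n+3}{2\alpha}$, let $f\in C^n(\mathbb{R})$ with $f^{(n)}\in L_1(\mathbb{R})$, and let $\xi>0$. Then $$\|K(x)\|_1\le\frac{1}{6\Gamma(\frac{1}{2\alpha})\Gamma(\beta-\frac{1}{2\alpha})(n-1)!}\Big[3\Gamma\left(\tfrac{n+1}{2\alpha}\right)\Gamma\left(\beta-\tfrac{n+1}{2\alpha}\right)+3\Gamma\left(\tfrac{n+2}{2\alpha}\right)\Gamma\left(\beta-\tfrac{n+2}{2\alpha}\right)+\Gamma\left(\tfrac{n+3}{2\alpha}\right)\Gamma\left(\beta-\tfrac{n+3}{2\alpha}\right)\Big]\omega_2(f^{(n)},\xi)_1\,\xi^n.$$ Hence $\|K(x)\|_1\to0$ as $\xi\to0$. If additionally $f^{(2m)}\in L_1(\mathbb{R})$ for $m=1,\dots,\frac n2$, then $\|M_\xi(f)-f\|_1\to0$ as $\xi\to0$.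
   Context: For $\alpha\in\mathbb{N}$, $\beta>\frac{1}{2\alpha}$, $\xi>0$, let $W=\frac{\Gamma(\beta)\alpha\xi^{2\alpha\beta-1}}{\Gamma(\frac{1}{2\alpha})\Gamma(\beta-\frac{1}{2\alpha})}$ and define $M_\xi(f;x)=W\int_{-\infty}^{\infty}f(x+y)\frac{1}{(y^{2\alpha}+\xi^{2\alpha})^{\beta}}dy$, $x\in\mathbb{R}$. Let $$K(x):=M_\xi(f;x)-f(x)-\sum_{\rho=1}^{n/2}\frac{f^{(2\rho)}(x)}{(2\rho)!}\frac{\Gamma(\frac{2\rho+1}{2\alpha})\Gamma(\beta-\frac{2\rho+1}{2\alpha})}{\Gamma(\frac{1}{2\alpha})\Gamma(\beta-\frac{1}{2\alpha})}\xi^{2\rho}.$$ For $g\in L_1(\mathbb{R})$, $\Delta_t^2g(x)=g(x+2t)-2g(x+t)+g(x)$ and $\omega_2(g,h)_1=\sup_{|t|\le h}\|\Delta_t^2g(x)\|_{1,x}$, $h>0$. *)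

(* Defs.v *)
From HB Require Import structures.
From mathcomp Require Import all_boot all_order all_algebra.
From mathcomp Require Import all_classical all_reals all_analysis.
Set Implicit Arguments. Unset Strict Implicit. Unset Printing Implicit Defensive.
Import Order.TTheory GRing.Theory Num.Theory.
Import numFieldNormedType.Exports.
Local Open Scope classical_set_scope.
Local Open Scope ring_scope.

Section Defs.
Variable R : realType.

Notation mu := (@lebesgue_measure R).

Definition Gamma (s : R) : R :=
  Rintegral mu `]0, +oo[ (fun t => t `^ (s - 1) * expR (- t)).

Definition Cn (n : nat) (f : R -> R) : Prop :=
  (forall k, (k < n)%N -> forall x : R, derivable (derive1n k f) x 1) /\
  continuous (derive1n n f).

Definition L1 (g : R -> R) : Prop := mu.-integrable setT (EFin \o g).

(* ||g||_1 as an extended real (= +oo iff g is not integrable) *)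
Definition norm1 (g : R -> R) : \bar R := (\int[mu]_x (`|g x|)%:E)%E.

Definition Delta2 (g : R -> R) (t : R) : R -> R :=
  fun x => g (x + 2 * t) - 2 * g (x + t) + g x.

Definition omega2 (g : R -> R) (h : R) : \bar R :=
  ereal_sup [set norm1 (Delta2 g t) | t in [set t : R | `|t| <= h]].

Definition Wc (alpha : nat) (beta xi : R) : R :=
  Gamma beta * alpha%:R * xi `^ (2 * alpha%:R * beta - 1) /
  (Gamma (1 / (2 * alpha%:R)) * Gamma (beta - 1 / (2 * alpha%:R))).

Definition Mxi (alpha : nat) (beta xi : R) (f : R -> R) (x : R) : R :=
  Wc alpha beta xi *
  Rintegral mu setT
    (fun y => f (x + y) / (y ^+ (2 * alpha) + xi ^+ (2 * alpha)) `^ beta).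

Definition Kfun (n alpha : nat) (beta xi : R) (f : R -> R) (x : R) : R :=
  Mxi alpha beta xi f x - f x -
  \sum_(1 <= rho < (n./2).+1)
    (derive1n (2 * rho) f x / ((2 * rho)`!)%:R *
     (Gamma ((2 * rho).+1%:R / (2 * alpha%:R)) *
      Gamma (beta - (2 * rho).+1%:R / (2 * alpha%:R))) /
     (Gamma (1 / (2 * alpha%:R)) * Gamma (beta - 1 / (2 * alpha%:R))) *
     xi ^+ (2 * rho)).

Definition Cconst (n alpha : nat) (beta : R) : R :=
  let a2 := 2 * alpha%:R in
  (3 * (Gamma (n.+1%:R / a2) * Gamma (beta - n.+1%:R / a2)) +
   3 * (Gamma (n.+2%:R / a2) * Gamma (beta - n.+2%:R / a2)) +
   Gamma (n.+3%:R / a2) * Gamma (beta - n.+3%:R / a2)) /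
  (6 * Gamma (1 / a2) * Gamma (beta - 1 / a2) * (n.-1)`!%:R).

End Defs.

(* Main.v *)
Require Import Defs.
From HB Require Import structures.
From mathcomp Require Import all_boot all_order all_algebra.
From mathcomp Require Import all_classical all_reals all_analysis.
From mathcomp Require Import measurable_realfun ring lra.
Set Implicit Arguments. Unset Strict Implicit. Unset Printing Implicit Defensive.
Import Order.TTheory GRing.Theory Num.Theory.
Import numFieldNormedType.Exports.
Local Open Scope classical_set_scope.
Local Open Scope ring_scope.

(* Write g for the n-th derivative of f and k for the kernel. By evenness of k
   only the symmetric combination f(x+y) + f(x-y) enters the operator. Its
   Taylor polynomial at y = 0 has only even terms, and the moments of k, which
   are Beta integrals, turn them into the terms subtracted in K; so K(x) is the
   integral of the Taylor remainder against k. That remainder is at most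
   y^(n-1)/(n-1)! times the integral over t in [0, y] of |Delta_t^2 g(x-t)|.
   Integrating in x (Tonelli, translation invariance) and using
   ||Delta_t^2 g||_1 <= (1 + t/xi)^2 omega_2(g, xi)_1, the integral of
   (1 + t/xi)^2 over [0, y] is y + y^2/xi + y^3/(3 xi^2), whence the moments of
   orders n, n+1, n+2 and the coefficients 3, 3, 1 over 6. The limits follow from
   omega_2(g, xi)_1 <= 4 ||g||_1. *)

(** * Integration on the half-line *)

(** Two obstacles shape the proof. Only the n-th derivative is integrable, not f, so convergence of
    the integral defining [Mxi] has to be derived: at fixed x and for y > 0, each of f(x + y) and
    f(x - y) differs from its degree n Taylor polynomial by at most (||g||_1 + |g(x)| y)
    y^(n-1)/(n-1)!, which the kernel integrates. And measurability of K in x is never established: K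
    is dominated pointwise by a measurable majorant built from g alone, and norms are compared
    through nonnegative integrals. The hypothesis on beta makes the moment of order n+2 converge,
    the highest one used. *)

Section integration_tools.
Context {R : realType}.
Notation mu := (@lebesgue_measure R).
Notation Rpos := (`]0%R, +oo[%classic : set R).
Implicit Types (c : R) (p : nat) (G : R -> R).
Local Open Scope ereal_scope.

Lemma is_derive_monomial c p (x : R) :
  is_derive x (1 : R)%R (fun y : R => c * y ^+ p)%R (c * (p%:R * x ^+ p.-1))%R.
Proof.
have -> : (fun y : R => c * y ^+ p)%R = (c \*: ((id : R -> R) ^+ p))%R.
  by apply/funext => y; rewrite !fctE.
by apply: is_derive_eq; rewrite /GRing.scale/= mulr1.
Qed.

Lemma ge0_le_integral_nonmeas d (T : measurableType d) (m : {measure set T -> \bar R})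
    (D : set T) (f g : T -> \bar R) :
  (forall x, D x -> 0 <= f x) -> (forall x, D x -> f x <= g x) ->
  \int[m]_(x in D) f x <= \int[m]_(x in D) g x.
Proof.
move=> f0 fg; have g0 x : D x -> 0 <= g x.
  by move=> Dx; exact: le_trans (f0 _ Dx) (fg _ Dx).
rewrite !ge0_integralE//; apply: ereal_sup_le => _ [h /= hf <-].
exists h => // x; apply: le_trans (hf x) _.
by apply: lee_restrict.
Qed.

(** Extension by zero off the product of A and B reduces this to Tonelli on the whole space. The
    sign is asked only on that product, because the powers y^j below may be negative off the
    half-line. *)
Lemma tonelli_on d1 d2 (T1 : measurableType d1) (T2 : measurableType d2)
    (m1 : {sigma_finite_measure set T1 -> \bar R})
    (m2 : {sigma_finite_measure set T2 -> \bar R})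
    (A : set T1) (B : set T2) (f : T1 * T2 -> \bar R) :
  measurable A -> measurable B -> measurable_fun setT f ->
  (forall x y, A x -> B y -> 0 <= f (x, y)) ->
  \int[m1]_(x in A) \int[m2]_(y in B) f (x, y) =
  \int[m2]_(y in B) \int[m1]_(x in A) f (x, y).
Proof.
move=> mA mB mf f0.
pose h := f \_ (A `*` B).
have mh : measurable_fun setT h.
  apply/(measurable_restrictT _ _).1; first exact: measurableX.
  exact: measurable_funS mf.
have h0 z : 0 <= h z by apply: erestrict_ge0 => -[x y] [/f0]; exact.
rewrite integral_mkcond [RHS]integral_mkcond.
transitivity (\int[m1]_x \int[m2]_y h (x, y)).
  apply: eq_integral => x _; rewrite patchE; case: ifPn => xA.
    rewrite integral_mkcond; apply: eq_integral => y _.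
    by rewrite /h !patchE in_setX/= xA.
  rewrite integral0_eq// => y _.
  by rewrite /h !patchE in_setX/= (negbTE xA).
rewrite (fubini_tonelli _ mh h0).
apply: eq_integral => y _; rewrite [RHS]patchE; case: ifPn => yB.
  rewrite [RHS]integral_mkcond; apply: eq_integral => x _.
  by rewrite /h !patchE in_setX/= yB andbT.
rewrite integral0_eq// => x _.
by rewrite /h !patchE in_setX/= (negbTE yB) andbF.
Qed.

Lemma measurable_fun_tonelli_on d1 d2 (T1 : measurableType d1)
    (T2 : measurableType d2) (m2 : {sigma_finite_measure set T2 -> \bar R})
    (B : set T2) (f : T1 * T2 -> \bar R) :
  measurable B -> measurable_fun setT f -> (forall x y, B y -> 0 <= f (x, y)) ->
  measurable_fun setT (fun x => \int[m2]_(y in B) f (x, y)).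
Proof.
move=> mB mf f0.
pose h := f \_ ([set: T1] `*` B).
have mh : measurable_fun setT h.
  apply/(measurable_restrictT _ _).1; first exact: measurableX.
  exact: measurable_funS mf.
have h0 z : 0 <= h z by apply: erestrict_ge0 => -[x y] [_ /f0]; exact.
have := @measurable_fun_fubini_tonelli_F _ _ _ _ _ m2 h mh h0.
apply: eq_measurable_fun => x _.
rewrite /fubini_F [RHS]integral_mkcond; apply: eq_integral => y _.
by rewrite /h !patchE in_setX/= in_setT.
Qed.

(** These intervals are the images of [1/(i+1), i+1] under x -> c x^p, the exhaustion that the
    substitution u = c x^p produces. *)
Lemma itv0y_bigcup_monomial c p : (0 < c)%R -> (0 < p)%N ->
  \bigcup_i `[(c * (i.+1%:R^-1) ^+ p)%R, (c * (i.+1%:R) ^+ p)%R]%classic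
    = Rpos.
Proof.
move=> c0 p0; apply/seteqP; split=> [u [i _]|u] /=; rewrite !in_itv/= ?andbT.
  move=> /andP[+ _]; apply: lt_le_trans.
  by rewrite mulr_gt0// exprn_gt0// invr_gt0.
move=> u0.
(* N + 1 is at least u/c and c/u and, being at least 1, is at most its own p-th power. *)
pose N := (Num.truncn (u / c) + Num.truncn (c / u))%N.
have leX (x : R) : (1 <= x -> x <= x ^+ p)%R.
  by move=> x1; rewrite -[leLHS]expr1 ler_weXn2l.
have N1 : (u / c <= N.+1%:R)%R.
  apply/ltW/(lt_le_trans (truncnS_gt _)); rewrite ler_nat ltnS; exact: leq_addr.
have N2 : (c / u <= N.+1%:R)%R.
  apply/ltW/(lt_le_trans (truncnS_gt _)); rewrite ler_nat ltnS; exact: leq_addl.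
have NX := leX N.+1%:R (ler1n _ _).
exists N => //=; rewrite in_itv/=; apply/andP; split.
  rewrite exprVn ler_pdivrMr ?exprn_gt0// -ler_pdivrMl// mulrC.
  exact: le_trans NX.
by rewrite -ler_pdivrMl// mulrC; exact: le_trans NX.
Qed.

Lemma cvg_integral_exhaust (F : (set R)^nat) (f : R -> \bar R) :
  nondecreasing_seq F -> (forall i, measurable (F i)) ->
  \bigcup_i F i = Rpos ->
  measurable_fun Rpos f -> (forall x : R, (0 < x)%R -> 0 <= f x) ->
  \int[mu]_(x in F i) f x @[i --> \oo] --> \int[mu]_(x in Rpos) f x.
Proof.
move=> ndF mF FE mf f0; rewrite -FE.
have FS i : F i `<=` Rpos by rewrite -FE; exact: bigcup_sup.
apply: ge0_nondecreasing_set_cvg_integral => //.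
  by move=> i; exact: measurable_funS mf.
by move=> i x /FS /=; rewrite in_itv/= andbT => /f0.
Qed.

(* The substitution theorems of the library require the integrand and the
   derivative of the change of variables to have limits at both ends of the
   half-line, which fails here; hence the exhaustion by compact intervals. *)
Lemma ge0_integration_by_substitution_monomial G c p : (0 < c)%R -> (0 < p)%N ->
  (forall x : R, (0 < x)%R -> {for x, continuous G}) ->
  (forall x : R, (0 < x)%R -> 0 <= G x)%R ->
  \int[mu]_(u in Rpos) (G u)%:E =
  \int[mu]_(x in Rpos)
    (G (c * x ^+ p) * (c * (p%:R * x ^+ p.-1)))%:E.
Proof.
move=> c0 p0 cG G0.
pose F x : R := (c * x ^+ p)%R.
have dF (x : R) : is_derive x (1 : R)%R F (c * (p%:R * x ^+ p.-1))%R.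
  exact: is_derive_monomial.
have dFE : F^`()%classic = (fun x => c * (p%:R * x ^+ p.-1))%R.
  by apply/funext => x; rewrite derive1E derive_val.
have cF : continuous F.
  by move=> x; apply/differentiable_continuous/derivable1_diffP; case: (dF x).
have cdF : continuous F^`()%classic.
  rewrite dFE => x; apply: cvgM; first exact: cvg_cst.
  by apply: cvgM; [exact: cvg_cst|exact: exprn_continuous].
have F0 (x : R) : (0 < x)%R -> (0 < F x)%R by move=> x0; rewrite mulr_gt0// exprn_gt0.
have cGF (x : R) : (0 < x)%R -> {for x, continuous ((G \o F) * F^`()%classic)%R}.
  move=> x0; apply: cvgM; last exact: cdF.
  by apply: continuous_comp; [exact: cF|apply: cG; exact: F0].
transitivity (\int[mu]_(x in Rpos) (((G \o F) * F^`()%classic) x)%:E); last first.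
  by apply: eq_integral => x _; rewrite fctE dFE.
have ivle (i j : nat) : (i <= j)%N -> (j.+1%:R^-1 <= i.+1%:R^-1 :> R)%R.
  by move=> ij; rewrite lef_pV2 ?posrE// ler_nat.
have hL := @cvg_integral_exhaust
  (fun i => `[(c * (i.+1%:R^-1) ^+ p)%R, (c * (i.+1%:R) ^+ p)%R]%classic) (EFin \o G).
have hR := @cvg_integral_exhaust
  (fun i => `[(i.+1%:R^-1)%R, i.+1%:R%R]%classic) (EFin \o ((G \o F) * F^`()%classic)%R).
have mcont (H : R -> R) : (forall x : R, (0 < x)%R -> {for x, continuous H}) ->
    measurable_fun Rpos (EFin \o H).
  move=> cH; apply/measurable_EFinP.
  apply: open_continuous_measurable_fun; first exact: interval_open.
  by move=> x /=; rewrite ?inE/= in_itv/= andbT; exact: cH.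
(* Both integrals are limits of one sequence: the integrals of G over the image intervals, which
   substitution on a compact interval turns into those over [1/(i+1), i+1]. *)
apply: (@cvg_unique _ (@ereal_hausdorff R) (\int[mu]_(x in
  `[(c * (i.+1%:R^-1) ^+ p)%R, (c * (i.+1%:R) ^+ p)%R]) (G x)%:E @[i --> \oo])).
  apply: hL.
  - apply/nondecreasing_seqP => i; apply/subsetPset; apply: subset_itv;
      rewrite bnd_simp ler_pM2l// lerXn2r ?nnegrE ?invr_ge0 ?ler_nat//.
    exact: ivle.
  - by move=> i; exact: measurable_itv.
  - exact: itv0y_bigcup_monomial.
  - exact: mcont.
  - by move=> x x0; rewrite lee_fin G0.
suff : \int[mu]_(x in (`[(i.+1%:R^-1)%R, i.+1%:R%R]%classic : set R))
    (((G \o F) * F^`()%classic) x)%:E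
    @[i --> \oo] --> \int[mu]_(x in Rpos) (((G \o F) * F^`()%classic) x)%:E.
  apply: cvg_trans; apply: near_eq_cvg; near=> i.
  have i0 : (0 < i.+1%:R^-1 :> R)%R by rewrite invr_gt0.
  have ii : (i.+1%:R^-1 <= i.+1%:R :> R)%R.
    by rewrite (le_trans (ivle 0%N i _))// invr1 ler1n.
  rewrite -integration_by_substitution_increasing//.
  - move=> x y; rewrite !in_itv/= => /andP[xi _] /andP[yi _] xy.
    by rewrite /F ltr_pM2l// ltrXn2r ?lt0n_neq0// (le_trans (ltW i0) xi).
  - by apply/cvg_ex; eexists; apply: cvg_at_right_filter; exact: cdF.
  - by apply/cvg_ex; eexists; apply: cvg_at_left_filter; exact: cdF.
  - split.
    + by move=> x _; case: (dF x).
    + by apply: cvg_at_right_filter; exact: cF.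
    + by apply: cvg_at_left_filter; exact: cF.
  - apply: continuous_in_subspaceT => x; rewrite inE/= in_itv/= => /andP[Fx _].
    by apply: cG; apply: lt_le_trans Fx; exact: F0.
apply: hR.
- apply/nondecreasing_seqP => i; apply/subsetPset; apply: subset_itv;
    rewrite bnd_simp ?ler_nat//.
  exact: ivle.
- by move=> i; exact: measurable_itv.
- by have := @itv0y_bigcup_monomial 1%R 1%N ltr01 isT => <-;
    apply: eq_bigcupr => i _; rewrite !expr1 !mul1r.
- exact: mcont.
- move=> x x0; rewrite lee_fin fctE dFE mulr_ge0//; first by apply: G0; exact: F0.
  by rewrite !mulr_ge0// ?exprn_ge0// ltW.
Unshelve. all: by end_near. Qed.

Lemma ge0_integral_translate G c : continuous G -> (forall x : R, 0 <= G x)%R ->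
  \int[mu]_x (G (x + c)%R)%:E = \int[mu]_x (G x)%:E.
Proof.
move=> cG G0.
have dF (x : R) : is_derive x (1 : R)%R (fun x : R => x + c)%R (1%R : R).
  by apply: is_derive_eq; rewrite addr0.
have dFE : (fun x : R => x + c)%R^`()%classic = cst 1%R.
  by apply/funext => x; rewrite derive1E derive_val.
rewrite [RHS](@increasing_ge0_integration_by_substitutionT _ (fun x => x + c)%R)//.
- by apply: eq_integral => x _; rewrite !fctE dFE mulr1.
- by move=> x y xy; rewrite ltrD2r.
- by rewrite dFE => x; exact: cvg_cst.
- by rewrite dFE; exact: is_cvg_cst.
- by rewrite dFE; exact: is_cvg_cst.
- exact: cvg_addrr_Ny.
- exact: cvg_addrr.
Qed.

End integration_tools.

(** * The Gamma function *)

Section gamma.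
Context {R : realType}.
Notation mu := (@lebesgue_measure R).
Notation Rpos := (`]0%R, +oo[%classic : set R).

Lemma is_derive1_comp (f g : R -> R) (x df dg : R) :
  is_derive x (1 : R) f df -> is_derive (f x) (1 : R) g dg ->
  is_derive x (1 : R) (g \o f) (dg * df).
Proof.
move=> [df1 df2] [dg1 dg2]; apply: DeriveDef.
  move: (df1) (dg1) => /derivable1_diffP df1' /derivable1_diffP dg1'.
  by apply/derivable1_diffP; exact: differentiable_comp df1' dg1'.
by rewrite -derive1E (derive1_comp df1 dg1) !derive1E df2 dg2.
Qed.

Lemma is_derive_continuous (f : R -> R) (x df : R) :
  is_derive x (1 : R) f df -> {for x, continuous f}.
Proof. by move=> [? _]; exact/differentiable_continuous/derivable1_diffP. Qed.

Lemma is_derive_addl (c x : R) : is_derive x (1 : R) (fun y : R => c + y) (1 : R).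
Proof.
by have := is_deriveD (is_derive_cst c x (1 : R)) (is_derive_id x (1 : R)); rewrite add0r.
Qed.

Let K (i : nat) : set R := `[i.+1%:R^-1, i.+1%:R]%classic.

Lemma cvg_integral_Rpos (f : R -> \bar R) :
  measurable_fun Rpos f -> (forall x : R, 0 < x -> (0 <= f x)%E) ->
  (\int[mu]_(x in K i) f x)%E @[i --> \oo] --> (\int[mu]_(x in Rpos) f x)%E.
Proof.
apply: cvg_integral_exhaust.
- apply/nondecreasing_seqP => i; apply/subsetPset; apply: subset_itv;
    by rewrite bnd_simp ?ler_nat// lef_pV2 ?posrE// ler_nat.
- by move=> i; exact: measurable_itv.
- have := @itv0y_bigcup_monomial R 1 1 ltr01 isT => <-.
  by apply: eq_bigcupr => i _; rewrite !expr1 !mul1r.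
Qed.

Lemma measurable_fun_Rpos (f : R -> R) :
  (forall x : R, 0 < x -> {for x, continuous f}) -> measurable_fun Rpos (EFin \o f).
Proof.
move=> cf; apply/measurable_EFinP.
apply: open_continuous_measurable_fun; first exact: interval_open.
by move=> x; rewrite inE/= in_itv/= andbT; exact: cf.
Qed.

(** On [1/(i+1), i+1] the fundamental theorem gives F(i+1) - F(1/(i+1)) <= M, as F is nonnegative.
    The exhaustion carries this to the half-line without limits of F at the ends. *)
Lemma integral_Rpos_le_primitive (f F : R -> R) (M : R) :
  (forall x : R, 0 < x -> 0 <= f x) ->
  (forall x : R, 0 < x -> {for x, continuous f}) ->
  (forall x : R, 0 < x -> is_derive x (1 : R) F (f x)) ->
  (forall x : R, 0 < x -> 0 <= F x <= M) ->
  (\int[mu]_(x in Rpos) (f x)%:E <= M%:E)%E.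
Proof.
move=> f0 cf dF FM.
have mf := measurable_fun_Rpos cf.
have cv := @cvg_integral_Rpos (EFin \o f) mf (fun x x0 => f0 x x0).
rewrite -(cvg_lim (@ereal_hausdorff R) cv); apply: lime_le.
  by apply/cvg_ex; eexists; exact: cv.
near=> i.
have i0 : (0 < i.+1%:R^-1 :> R) by rewrite invr_gt0.
have : (i.+1%:R^-1 <= i.+1%:R :> R).
  by rewrite (@le_trans _ _ 1) ?ler1n// invf_le1// ler1n.
have /andP[F10 F1M] := FM _ i0.
(* For i = 0 the interval is the single point 1, which the fundamental theorem, stated for a < b,
   does not cover. *)
rewrite le_eqVlt => /orP[/eqP ie|ii].
  by rewrite /K ie set_itv1 integral_set1 lee_fin (le_trans F10).
have P x : x \in `[i.+1%:R^-1, i.+1%:R]%R -> 0 < x.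
  by rewrite in_itv/= => /andP[+ _]; exact: lt_le_trans.
rewrite (@continuous_FTC2 _ f F)//.
- have /andP[F20 F2M] := FM _ (lt_trans i0 ii).
  by rewrite -EFinB lee_fin lerBlDr (le_trans F2M)// lerDl.
- apply: continuous_in_subspaceT => x; rewrite inE/= => /P x0.
  exact: cf.
- split.
  + move=> x /subset_itv_oo_cc /P x0; by case: (dF _ x0).
  + apply: cvg_at_right_filter; exact: is_derive_continuous (dF _ i0).
  + apply: cvg_at_left_filter; exact: is_derive_continuous (dF _ (lt_trans i0 ii)).
- move=> x /subset_itv_oo_cc /P x0; rewrite derive1E.
  by have [_ ->] := dF _ x0.
Unshelve. all: by end_near. Qed.

(** With y = x/r, use y <= 1 + y <= e^y and raise to the power r. *)
Lemma powR_le_expR (r x : R) : 0 < r -> 0 <= x -> x `^ r <= r `^ r * expR x.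
Proof.
move=> r0 x0; have -> : x = r * (x / r) by rewrite mulrC divfK ?gt_eqF.
have xr : 0 <= x / r by rewrite divr_ge0// ltW.
rewrite powRM ?(ltW r0)// ler_wpM2l ?powR_ge0//.
rewrite [r * _]mulrC expRM ge0_ler_powR ?nnegrE ?expR_ge0 ?(ltW r0)//.
by rewrite (le_trans _ (expR_ge1Dx _))// lerDr.
Qed.

Definition gamma_fun (s t : R) : R := t `^ (s - 1) * expR (- t).

Lemma gamma_fun_ge0 s t : 0 <= gamma_fun s t.
Proof. by rewrite mulr_ge0// ?powR_ge0// expR_ge0. Qed.

Lemma continuous_powR_gt0 (a x : R) : 0 < x -> {for x, continuous (fun y : R => y `^ a)}.
Proof. by move=> x0; apply: is_derive_continuous; exact: is_derive1_powR. Qed.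

Lemma continuous_gamma_fun (s x : R) : 0 < x -> {for x, continuous (gamma_fun s)}.
Proof.
move=> x0; apply: cvgM; first exact: continuous_powR_gt0.
apply: continuous_comp; first exact: opp_continuous.
exact: continuous_expR.
Qed.

(* [t^(s-1) e^(-t)] is dominated by a multiple of the derivative
   [s t^(s-1) (1+t)^(-s-1)] of the bounded function [(t / (1+t))^s]. *)
Lemma gamma_fun_integral_lty (s : R) : 0 < s ->
  (\int[mu]_(t in Rpos) (gamma_fun s t)%:E < +oo)%E.
Proof.
move=> s0.
pose f (t : R) := s * t `^ (s - 1) * (1 + t) `^ (- s - 1).
pose F (t : R) := t `^ s * (1 + t) `^ (- s).
have t1 (t : R) : 0 < t -> 0 < 1 + t by move=> t0; rewrite addr_gt0.
have dF (t : R) : 0 < t -> is_derive t (1 : R) F (f t).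
  move=> t0.
  have d1 : is_derive t (1 : R) (fun t : R => 1 + t) (1 : R).
    exact: is_derive_addl.
  have d2 := is_derive1_powR s t0.
  have d3 := is_derive1_comp d1 (is_derive1_powR (- s) (t1 _ t0)).
  have := is_deriveM d2 d3; rewrite /GRing.scale/= => d.
  apply: is_derive_eq d _; rewrite mulr1 /f.
  rewrite -{1}(mulr_powRB1 (ltW t0) s0).
  have -> : (1 + t) `^ (- s) = (1 + t) * (1 + t) `^ (- s - 1).
    rewrite -[in LHS](_ : 1 + (- s - 1) = - s); last by ring.
    rewrite powRD ?powRr1 ?(ltW (t1 _ t0))//.
    by rewrite (gt_eqF (t1 _ t0)) implybT.
  ring.
have cf (t : R) : 0 < t -> {for t, continuous f}.
  move=> t0; apply: cvgM.
    by apply: cvgM; [exact: cvg_cst|exact: continuous_powR_gt0].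
  apply: (@continuous_comp _ _ _ (fun t : R => 1 + t) (fun y : R => y `^ (- s - 1))).
    by apply: cvgD; [exact: cvg_cst|exact: cvg_id].
  by apply: continuous_powR_gt0; exact: t1.
have fint : (\int[mu]_(t in Rpos) (f t)%:E <= 1)%E.
  apply: (@integral_Rpos_le_primitive f F) => //.
  - by move=> t t0; rewrite !mulr_ge0// ?powR_ge0// ltW.
  - move=> t t0; rewrite /F mulr_ge0 ?powR_ge0//= powRN ler_pdivrMr ?powR_gt0 ?t1//.
    by rewrite mul1r ge0_ler_powR ?nnegrE ?(ltW s0) ?(ltW t0) ?(ltW (t1 _ t0))// lerDr.
(* The constant comes from (1+t)^(s+1) <= (s+1)^(s+1) e^(1+t), divided by the factor s present in
   [f]. *)
pose C := (s + 1) `^ (s + 1) * expR 1 / s.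
have C0 : 0 <= C by rewrite !mulr_ge0 ?powR_ge0 ?expR_ge0 ?invr_ge0 ?ltW.
have mf := measurable_fun_Rpos cf.
apply: (@le_lt_trans _ _ (C%:E * \int[mu]_(t in Rpos) (f t)%:E)%E); last first.
  apply: (@le_lt_trans _ _ (C%:E * 1)%E); last by rewrite mule1 ltry.
  by rewrite lee_wpmul2l// lee_fin.
rewrite -ge0_integralZl_EFin//; last first.
  by move=> t _; rewrite lee_fin !mulr_ge0 ?powR_ge0 ?ltW.
apply: ge0_le_integral_nonmeas => t; first by rewrite lee_fin gamma_fun_ge0.
rewrite /= in_itv/= andbT => t0; rewrite -EFinM lee_fin /gamma_fun /C /f.
have := @powR_le_expR (s + 1) (1 + t) (addr_gt0 s0 ltr01) (ltW (t1 _ t0)).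
rewrite expRD mulrA => h.
rewrite (_ : _ / s * _ =
  t `^ (s - 1) * ((s + 1) `^ (s + 1) * expR 1 * (1 + t) `^ (- s - 1))); last first.
  by field; rewrite gt_eqF.
rewrite ler_wpM2l ?powR_ge0// (_ : - s - 1 = - (s + 1)); last by ring.
by rewrite powRN ler_pdivlMr ?powR_gt0 ?t1// expRN mulrC ler_pdivrMr ?expR_gt0.
Qed.

(** [Gamma] is defined through [fine], which sends an infinite integral to 0; the finiteness just
    proved excludes this default for positive s. *)
Lemma integral_gamma_fun (s : R) : 0 < s ->
  (\int[mu]_(t in Rpos) (gamma_fun s t)%:E = (Gamma s)%:E)%E.
Proof.
move=> s0; rewrite /Gamma /Rintegral fineK//.
rewrite ge0_fin_numE; first exact: gamma_fun_integral_lty.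
by apply: integral_ge0 => t _; rewrite lee_fin gamma_fun_ge0.
Qed.

(** On [1, 2], for every s > 0, t^s >= 1 gives t^(s-1) >= 1/t >= 1/2, and e^(-t) >= e^(-2). *)
Lemma Gamma_gt0 (s : R) : 0 < s -> 0 < Gamma s.
Proof.
move=> s0; rewrite -lte_fin -integral_gamma_fun//.
have mg := measurable_fun_Rpos (@continuous_gamma_fun s).
have sub : `[1%R, 2%R]%classic `<=` Rpos.
  by move=> x /=; rewrite !in_itv/= andbT => /andP[x1 _]; exact: lt_le_trans x1.
apply: (@lt_le_trans _ _ (\int[mu]_(t in `[1%R, 2%R]) (2^-1 * expR (- 2))%:E)%E).
  rewrite integral_cst//= lebesgue_measure_itv/= lte_fin ltr1n.
  by rewrite -EFinB -EFinM lte_fin !mulr_gt0 ?expR_gt0// subr_gt0 ltr1n.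
apply: (@le_trans _ _ (\int[mu]_(t in `[1%R, 2%R]) (gamma_fun s t)%:E)%E); last first.
  apply: ge0_subset_integral => //.
  by move=> x _; rewrite lee_fin gamma_fun_ge0.
apply: ge0_le_integral_nonmeas => x /=; rewrite in_itv/= => /andP[x1 x2].
  by rewrite lee_fin mulr_ge0// expR_ge0.
have x0 : 0 < x by exact: lt_le_trans x1.
rewrite lee_fin ler_pM ?invr_ge0 ?expR_ge0//; last by rewrite ler_expR lerN2.
have -> : x `^ (s - 1) = x `^ s / x.
  by rewrite -(mulr_powRB1 (ltW x0) s0) mulrC mulKf// gt_eqF.
have h1 : 1 <= x `^ s.
  have <- : (1 : R) `^ s = 1 by rewrite powR1.
  by rewrite ge0_ler_powR ?nnegrE// ltW.
by rewrite (le_trans _ (ler_peMl _ h1)) ?invr_ge0 ?(ltW x0)// lef_pV2 ?posrE.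
Qed.

End gamma.

(** * Moments of the kernel *)

Section moments.
Context {R : realType}.
Notation mu := (@lebesgue_measure R).
Notation Rpos := (`]0%R, +oo[%classic : set R).

Lemma measurable_fun_powR d (T : measurableType d) (D : set T) (f : T -> R) (b : R) :
  measurable_fun D f -> measurable_fun D (fun x => f x `^ b).
Proof. by move=> mf; exact: (measurableT_comp (measurable_powR b) mf). Qed.

Lemma measurable_fun_expRN d (T : measurableType d) (D : set T) (f : T -> R) :
  measurable_fun D f -> measurable_fun D (fun x => expR (- f x)).
Proof.
move=> mf; apply: (measurableT_comp (@measurable_expR R)).
exact: (measurableT_comp (@oppr_measurable R setT) mf).
Qed.

Lemma RposP (x : R) : x \in Rpos -> 0 < x.
Proof. by rewrite inE/= in_itv/= andbT. Qed.

Lemma integral_powR_expR (b c : R) : 0 < b -> 0 < c ->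
  (\int[mu]_(t in Rpos) (t `^ (b - 1) * expR (- (c * t)))%:E =
   (Gamma b * c `^ (- b))%:E)%E.
Proof.
move=> b0 c0.
transitivity (\int[mu]_(t in Rpos) ((c `^ (- b))%:E *
    (gamma_fun b (c * t ^+ 1) * (c * (1%:R * t ^+ 0)))%:E))%E.
  apply: eq_integral => t /RposP t0; rewrite -EFinM; congr EFin.
  rewrite /gamma_fun expr1 expr0 powRM ?ltW// powRN -(mulr_powRB1 (ltW c0) b0).
  by field; rewrite !gt_eqF// powR_gt0.
rewrite ge0_integralZl_EFin ?powR_ge0//.
- rewrite -(@ge0_integration_by_substitution_monomial R (gamma_fun b) c 1)//.
  + by rewrite integral_gamma_fun// -EFinM mulrC.
  + by move=> x; exact: continuous_gamma_fun.
  + by move=> x _; exact: gamma_fun_ge0.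
- move=> t /mem_set/RposP t0.
  by rewrite lee_fin mulr_ge0 ?gamma_fun_ge0// !mulr_ge0 ?(ltW c0).
- apply: measurable_fun_Rpos => y y0; apply: cvgM; last first.
    apply: cvgM; first exact: cvg_cst.
    by apply: cvgM; [exact: cvg_cst|exact: exprn_continuous].
  apply: (@continuous_comp _ _ _ (fun y : R => c * y ^+ 1) (gamma_fun b)).
    by apply: cvgM; [exact: cvg_cst|exact: exprn_continuous].
  by apply: continuous_gamma_fun; rewrite mulr_gt0// exprn_gt0.
Qed.

(** Substitute u = t y^p: since p a = j + 1, y^j dy is a constant multiple of u^(a-1) du. *)
Lemma integral_monomial_expR (p j : nat) (a t : R) : (0 < p)%N ->
  p%:R * a = j.+1%:R -> 0 < t ->
  (\int[mu]_(y in Rpos) (y ^+ j * expR (- (t * y ^+ p)))%:E =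
   (Gamma a / p%:R * t `^ (- a))%:E)%E.
Proof.
move=> p0 paj t0.
have p0R : 0 < p%:R :> R by rewrite ltr0n.
have a0 : 0 < a by rewrite -(pmulr_rgt0 _ p0R) paj.
transitivity (\int[mu]_(y in Rpos) ((t `^ (- a) / p%:R)%:E *
    (gamma_fun a (t * y ^+ p) * (t * (p%:R * y ^+ p.-1)))%:E))%E.
  apply: eq_integral => y /RposP y0; rewrite -EFinM; congr EFin.
  have yp0 : 0 < y ^+ p by exact: exprn_gt0.
  have e : y ^+ j = y ^+ p.-1 * (y ^+ p) `^ (a - 1).
    apply: (mulfI (lt0r_neq0 y0)); rewrite -exprS mulrA -exprS prednK//.
    rewrite mulr_powRB1 ?(ltW yp0)// -[y ^+ p]powR_mulrn ?(ltW y0)// -powRrM paj.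
    by rewrite powR_mulrn ?ltW.
  rewrite /gamma_fun powRM ?(ltW yp0) ?(ltW t0)// powRN.
  rewrite -(mulr_powRB1 (ltW t0) a0) e.
  by field; rewrite !gt_eqF// powR_gt0.
rewrite ge0_integralZl_EFin ?divr_ge0 ?powR_ge0//.
- rewrite -(@ge0_integration_by_substitution_monomial R (gamma_fun a) t p)//.
  + by rewrite integral_gamma_fun// -EFinM; congr EFin; ring.
  + by move=> x; exact: continuous_gamma_fun.
  + by move=> x _; exact: gamma_fun_ge0.
- move=> y /mem_set/RposP y0.
  by rewrite lee_fin mulr_ge0 ?gamma_fun_ge0// !mulr_ge0 ?exprn_ge0 ?(ltW t0) ?(ltW y0).
- apply: measurable_fun_Rpos => y y0; apply: cvgM; last first.
    apply: cvgM; first exact: cvg_cst.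
    by apply: cvgM; [exact: cvg_cst|exact: exprn_continuous].
  apply: (@continuous_comp _ _ _ (fun y : R => t * y ^+ p) (gamma_fun a)).
    by apply: cvgM; [exact: cvg_cst|exact: exprn_continuous].
  by apply: continuous_gamma_fun; rewrite mulr_gt0// exprn_gt0.
Qed.

Lemma continuous_kernel (p j : nat) (b q x : R) : 0 < x ^+ p + q ->
  {for x, continuous (fun y : R => y ^+ j / (y ^+ p + q) `^ b)}.
Proof.
move=> xq; apply: cvgM; first exact: exprn_continuous.
apply: cvgV; first by rewrite gt_eqF// powR_gt0.
apply: (@continuous_comp _ _ _ (fun y : R => y ^+ p + q) (fun y : R => y `^ b)).
  by apply: cvgD; [exact: exprn_continuous|exact: cvg_cst].
exact: continuous_powR_gt0.
Qed.

(* Write Gamma(b) c^(-b) as the integral of t^(b-1) e^(-ct) with c = y^p + q and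
   exchange the integrations in y and t. *)
Lemma integral_moment (p j : nat) (a b q : R) : (0 < p)%N ->
  p%:R * a = j.+1%:R -> a < b -> 0 < q ->
  (\int[mu]_(y in Rpos) (y ^+ j / (y ^+ p + q) `^ b)%:E =
   (Gamma a * Gamma (b - a) / (p%:R * Gamma b) * q `^ (- (b - a)))%:E)%E.
Proof.
move=> p0 paj ab q0.
have p0R : 0 < p%:R :> R by rewrite ltr0n.
have a0 : 0 < a by rewrite -(pmulr_rgt0 _ p0R) paj.
have b0 : 0 < b by exact: lt_trans ab.
have ba0 : 0 < b - a by rewrite subr_gt0.
pose F (z : R * R) : \bar R :=
  (z.1 ^+ j * z.2 `^ (b - 1) * expR (- ((z.1 ^+ p + q) * z.2)))%:E.
have F0 x y : Rpos x -> Rpos y -> (0 <= F (x, y))%E.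
  move=> /mem_set/RposP x0 /mem_set/RposP y0.
  by rewrite lee_fin /= !mulr_ge0 ?powR_ge0 ?exprn_ge0 ?ltW// expR_gt0.
have mF : measurable_fun setT F.
  apply/measurable_EFinP; apply: measurable_funM; first apply: measurable_funM.
  - by apply: measurable_funX; exact: measurable_fst.
  - by apply: measurable_fun_powR; exact: measurable_snd.
  - apply: measurable_fun_expRN.
    apply: measurable_funM => //; apply: measurable_funD => //.
    by apply: measurable_funX; exact: measurable_fst.
have tF (y : R) : 0 < y -> (\int[mu]_(t in Rpos) F (y, t) =
    (Gamma b)%:E * (y ^+ j / (y ^+ p + q) `^ b)%:E)%E.
  move=> y0; have yq : 0 < y ^+ p + q by rewrite addr_gt0// exprn_gt0.
  under eq_integral => t _ do rewrite /F/= -mulrA EFinM.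
  rewrite ge0_integralZl_EFin ?exprn_ge0 ?(ltW y0)//.
  - rewrite integral_powR_expR// -!EFinM powRN; congr EFin; ring.
  - by move=> t _; rewrite lee_fin mulr_ge0 ?powR_ge0 ?expR_ge0.
  - apply/measurable_EFinP/measurable_funM.
      exact: measurable_fun_powR.
    apply: measurable_fun_expRN.
    by apply: measurable_funM.
have Gb := Gamma_gt0 b0.
transitivity ((Gamma b)^-1%:E *
    \int[mu]_(y in Rpos) \int[mu]_(t in Rpos) F (y, t))%E.
  rewrite -ge0_integralZl_EFin ?invr_ge0 ?(ltW Gb)//; last 2 first.
  - by move=> y y0; apply: integral_ge0 => t t0; exact: F0.
  - apply: (eq_measurable_fun (fun y : R =>
      (Gamma b)%:E * (y ^+ j / (y ^+ p + q) `^ b)%:E)%E).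
      by move=> y /RposP y0; rewrite tF.
    apply: measurable_funeM; apply: measurable_fun_Rpos => y y0.
    by apply: continuous_kernel; rewrite addr_gt0// exprn_gt0.
  apply: eq_integral => y /RposP y0; rewrite tF// -!EFinM mulKf//.
  by rewrite gt_eqF.
have -> : (\int[mu]_(y in Rpos) \int[mu]_(t in Rpos) F (y, t) =
           \int[mu]_(t in Rpos) \int[mu]_(y in Rpos) F (y, t))%E.
  by apply: tonelli_on => //; exact: measurable_itv.
(* The y-integral contributes t^(-a), so t^(b-1) becomes t^(b-a-1): a second Gamma integral, with
   parameter b - a and scale q. *)
transitivity ((Gamma b)^-1%:E * \int[mu]_(t in Rpos)
   ((Gamma a / p%:R)%:E * (t `^ (b - a - 1) * expR (- (q * t)))%:E))%E.
  congr (_ * _)%E; apply: eq_integral => t /RposP t0.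
  transitivity (\int[mu]_(y in Rpos) ((t `^ (b - 1) * expR (- (q * t)))%:E *
    (y ^+ j * expR (- (t * y ^+ p)))%:E))%E.
    apply: eq_integral => y _; rewrite /F/= -EFinM; congr EFin.
    rewrite mulrDl opprD expRD [y ^+ p * t]mulrC; ring.
  rewrite ge0_integralZl_EFin ?mulr_ge0 ?powR_ge0 ?expR_ge0//.
  - rewrite (integral_monomial_expR p0 paj t0) -!EFinM; congr EFin.
    rewrite (_ : b - a - 1 = (b - 1) + (- a)); last by ring.
    rewrite [t `^ (b - 1 - a)]powRD; first ring.
    by rewrite (gt_eqF t0) implybT.
  - move=> y /mem_set/RposP y0.
    by rewrite lee_fin mulr_ge0 ?exprn_ge0 ?expR_ge0 ?ltW.
  - apply/measurable_EFinP/measurable_funM.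
      by apply: measurable_funX.
    apply: measurable_fun_expRN.
    by apply: measurable_funM => //; apply: measurable_funX.
rewrite ge0_integralZl_EFin ?divr_ge0 ?(ltW (Gamma_gt0 a0)) ?(ltW p0R)//.
- rewrite integral_powR_expR// -!EFinM; congr EFin.
  by rewrite invfM; ring.
- by move=> t _; rewrite lee_fin mulr_ge0 ?powR_ge0 ?expR_ge0.
- apply/measurable_EFinP/measurable_funM.
    exact: measurable_fun_powR.
  apply: measurable_fun_expRN.
  by apply: measurable_funM.
Qed.

End moments.

(** * Taylor expansion with integral bound *)

Section taylor.
Context {R : realType}.
Notation mu := (@lebesgue_measure R).

(* The sharp constant 1/(i+1)! requires comparing derivatives; the mean value
   theorem alone would only give 1/i!. *)
Lemma derive_monomial_bound (h dh : R -> R) (C Y : R) (i : nat) :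
  (forall y : R, is_derive y (1 : R) h (dh y)) -> h 0 = 0 ->
  (forall y : R, 0 <= y <= Y -> `|dh y| <= C * (y ^+ i / i`!%:R)) ->
  forall y : R, 0 <= y <= Y -> `|h y| <= C * (y ^+ i.+1 / i.+1`!%:R).
Proof.
move=> dhP h0 dhC y /andP[y0 yY].
(* A sign s, taken as 1 and then -1, handles both halves of the absolute value; for each, [u]
   vanishes at 0 and is nondecreasing on [0, y]. *)
have key (s : R) : `|s| = 1 -> s * h y <= C * (y ^+ i.+1 / i.+1`!%:R).
  move=> s1.
  pose u (z : R) := C / i.+1`!%:R * z ^+ i.+1 - s * h z.
  have du (z : R) : is_derive z (1 : R) u (C * (z ^+ i / i`!%:R) - s * dh z).
    have d1 := @is_derive_monomial R (C / i.+1`!%:R) i.+1 z.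
    have d2 := is_deriveZ s (dhP z).
    have := is_deriveB d1 d2; move=> d; apply: (is_derive_eq d); congr (_ - _).
    rewrite factS natrM/= invfM; field.
    by rewrite nat1r !pnatr_eq0 -lt0n fact_gt0.
  have cu : continuous u by move=> z; exact: is_derive_continuous (du z).
  have : u 0 <= u y.
    apply: (@ger0_derive1_le_cc _ u 0 y) => //.
    - move=> z /subset_itv_oo_cc; rewrite in_itv/= => /andP[z0 zy].
      rewrite derive1E; have [_ ->] := du z; rewrite subr_ge0.
      rewrite (le_trans (ler_norm _))// normrM s1 mul1r dhC// z0/=.
      exact: le_trans yY.
    - exact: continuous_subspaceT.
    - by rewrite in_itv/= lexx.
    - by rewrite in_itv/= lexx y0.
  rewrite /u h0 expr0n/= !mulr0 subrr subr_ge0 => /le_trans; apply.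
  by rewrite mulrAC -mulrA.
have := key 1 (normr1 _); have := key (-1) (normrN1 _).
by rewrite mul1r mulN1r => h1 h2; rewrite ler_norml h2 andbT lerNl.
Qed.

(** Against y^k/k! differentiation is a shift of the coefficients, so a sequence of derivatives at 0
    serves as [c] unchanged. *)
Definition taylor_sum (N : nat) (c : nat -> R) (y : R) : R :=
  \sum_(k < N) c k * (y ^+ k / k`!%:R).

Lemma taylor_sum0 (N : nat) (c : nat -> R) : taylor_sum N.+1 c 0 = c 0%N.
Proof.
rewrite /taylor_sum big_ord_recl expr0 divr1 mulr1 big1 ?addr0// => k _.
by rewrite expr0n/= mul0r mulr0.
Qed.

Lemma is_derive_taylor_sum (N : nat) (c : nat -> R) (y : R) :
  is_derive y (1 : R) (taylor_sum N.+1 c) (taylor_sum N (c \o S) y).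
Proof.
elim: N => [|N IH].
  rewrite {2}/taylor_sum big_ord0.
  have -> : taylor_sum 1 c = cst (c 0%N).
    by apply/funext => z; rewrite /taylor_sum big_ord1 expr0 divr1 mulr1.
  exact: is_derive_cst.
have -> : taylor_sum N.+2 c =
    taylor_sum N.+1 c + (fun z => c N.+1 / N.+1`!%:R * z ^+ N.+1).
  apply/funext => z; rewrite /taylor_sum big_ord_recr/= !fctE; congr (_ + _).
  by rewrite mulrAC -mulrA.
have := is_deriveD IH (@is_derive_monomial R (c N.+1 / N.+1`!%:R) N.+1 y).
move=> d; apply: (is_derive_eq d); rewrite {2}/taylor_sum big_ord_recr/=; congr (_ + _).
rewrite factS natrM invfM; field.
by rewrite nat1r !pnatr_eq0 -lt0n fact_gt0.
Qed.

(** [U] lists successive derivatives. Subtracting also the term of degree m + 1 puts the difference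
    U_(m+1)(t) - U_(m+1)(0) under the integral, as U_0(y) - U_0(0) - U_1(0) y shows for m = 0; each
    further integration shifts [U] by one. A single C, bounding the integral over [0, Y], serves all
    y <= Y, which the induction needs. *)
Lemma taylor_bound (m : nat) (U : nat -> R -> R) (C Y : R) :
  (forall k, (k <= m)%N -> forall y : R, is_derive y (1 : R) (U k) (U k.+1 y)) ->
  continuous (U m.+1) ->
  (\int[mu]_(t in `[0%R, Y]) (`|U m.+1 t - U m.+1 0|)%:E <= C%:E)%E ->
  forall y : R, 0 <= y <= Y ->
  `|U 0%N y - taylor_sum m.+2 (fun k => U k 0) y| <= C * (y ^+ m / m`!%:R).
Proof.
elim: m U => [|m IH] U dU cU UC y.
  move=> /andP[y0 yY]; rewrite expr0 divr1 mulr1.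
  rewrite /taylor_sum !big_ord_recl big_ord0 addr0 expr0 expr1 !divr1 mulr1.
  pose v (t : R) := U 1%N t - U 1%N 0.
  pose V (t : R) := U 0%N t - U 1%N 0 * t ^+ 1.
  have cv : continuous v by move=> t; apply: cvgB; [exact: cU|exact: cvg_cst].
  have dV (t : R) : is_derive t (1 : R) V (v t).
    have := is_deriveB (dU 0%N isT t) (@is_derive_monomial R (U 1%N 0) 1 t).
    by move=> d; apply: (is_derive_eq d); rewrite expr0 mulr1 mulr1.
  have -> : U 0%N y - (U 0%N 0 + U (bump 0 0) 0 * y) = V y - V 0.
    by rewrite /V /bump/=; ring.
  rewrite -lee_fin; apply: le_trans UC.
  move: y0; rewrite le_eqVlt => /orP[/eqP <-|y0].
    by rewrite subrr normr0; apply: integral_ge0 => t _; rewrite lee_fin.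
  have cV : continuous V by move=> t; exact: is_derive_continuous (dV t).
  have ftc : (\int[mu]_(t in `[0%R, y]) (v t)%:E = (V y)%:E - (V 0)%:E)%E.
    apply: continuous_FTC2 => //.
    - exact: continuous_subspaceT.
    - split.
      + by move=> t _; case: (dV t).
      + by apply: cvg_at_right_filter; exact: cV.
      + by apply: cvg_at_left_filter; exact: cV.
    - by move=> t _; rewrite derive1E; have [_ ->] := dV t.
  rewrite -abse_EFin EFinB -ftc.
  have mv (D : set R) : measurable_fun D v.
    by apply: measurable_funTS; exact: continuous_measurable_fun.
  apply: (le_trans (le_abse_integral _ _ _)) => //.
    by apply/measurable_EFinP; exact: mv.
  apply: ge0_subset_integral => //.
  - by apply/measurable_EFinP; apply: measurableT_comp => //; exact: mv.
  - by move=> t /=; rewrite !in_itv/= => /andP[-> ty]; exact: le_trans yY.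
apply: (@derive_monomial_bound
    (fun y => U 0%N y - taylor_sum m.+3 (fun k => U k 0) y)
    (fun y => U 1%N y - taylor_sum m.+2 (fun k => U k.+1 0) y)).
- move=> z; have := is_deriveB (dU 0%N isT z) (is_derive_taylor_sum m.+2 (fun k => U k 0) z).
  exact.
- by rewrite taylor_sum0 subrr.
- move=> z zY; apply: (IH (fun k => U k.+1)) => //.
  by move=> k km; exact: dU.
Qed.

End taylor.

(** * The second modulus of smoothness *)

Section modulus.
Context {R : realType}.
Notation mu := (@lebesgue_measure R).
Implicit Types g H : R -> R.

Lemma norm1_ge0 g : (0 <= norm1 g)%E.
Proof. by apply: integral_ge0 => x _; rewrite lee_fin. Qed.

Lemma continuous_translate g (c : R) : continuous g -> continuous (fun x => g (x + c)).
Proof.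
move=> cg x; apply: (@continuous_comp _ _ _ (fun x : R => x + c) g); last exact: cg.
by apply: cvgD; [exact: cvg_id|exact: cvg_cst].
Qed.

Lemma measurable_norm g : continuous g ->
  measurable_fun setT (fun x => (`|g x|)%:E).
Proof.
move=> cg; apply/measurable_EFinP; apply: measurableT_comp => //.
exact: continuous_measurable_fun.
Qed.

Lemma norm1_translate g (c : R) : continuous g ->
  norm1 (fun x => g (x + c)) = norm1 g.
Proof.
move=> cg; rewrite /norm1 (ge0_integral_translate (G := fun x => `|g x|))//.
by move=> x; apply: cvg_norm; exact: cg.
Qed.

Lemma continuous_sum_ord (F : nat -> R -> R) (m : nat) :
  (forall j, continuous (F j)) -> continuous (fun x => \sum_(j < m) F j x).
Proof.
move=> cF; elim: m => [|m IH].
  have -> : (fun x => \sum_(j < 0) F j x) = cst 0.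
    by apply/funext => x; rewrite big_ord0.
  by move=> x; exact: cvg_cst.
have -> : (fun x => \sum_(j < m.+1) F j x) = (fun x => \sum_(j < m) F j x + F m x).
  by apply/funext => x; rewrite big_ord_recr.
by move=> x; apply: cvgD; [exact: IH|exact: cF].
Qed.

Lemma norm1_sum_translate_le g H (m : nat) (a : nat -> R) : continuous H ->
  (forall x, g x = \sum_(i < m) H (x + a i)) ->
  (norm1 g <= m%:R%:E * norm1 H)%E.
Proof.
move=> cH gE.
apply: (@le_trans _ _ (\int[mu]_x \sum_(i < m) (`|H (x + a i)|)%:E)%E).
  apply: ge0_le_integral_nonmeas => x _; first by rewrite lee_fin.
  by rewrite sumEFin lee_fin gE ler_norm_sum.
rewrite ge0_integral_sum//; last first.
  by move=> i; apply: measurable_norm; exact: continuous_translate.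
rewrite (eq_bigr (fun=> norm1 H)); last first.
  by move=> i _; rewrite -(norm1_translate (a i) cH).
by rewrite sumr_const card_ord mule_natl.
Qed.

(** A difference of step m s telescopes into m differences of step s; doing this for each of the two
    differences that make up [Delta2] gives m^2 translates. *)
Lemma Delta2_mul_sum g (s x : R) (m : nat) :
  Delta2 g (m%:R * s) x =
  \sum_(i < m) \sum_(j < m) Delta2 g s (x + i%:R * s + j%:R * s).
Proof.
have tele (f : R -> R) (z : R) :
    f (z + m%:R * s) - f z = \sum_(i < m) (f (z + i%:R * s + s) - f (z + i%:R * s)).
  have := telescope_sumr (fun i => f (z + i%:R * s)) (leq0n m).
  rewrite mul0r addr0 => <-; rewrite big_mkord; apply: eq_bigr => i _.
  by rewrite -natr1 mulrDl mul1r addrA.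
pose psi z := g (z + m%:R * s) - g z.
pose chi z := g (z + s) - g z.
transitivity (psi (x + m%:R * s) - psi x).
  rewrite /Delta2 /psi (_ : x + 2 * _ = x + m%:R * s + m%:R * s); first by ring.
  by ring.
rewrite tele; apply: eq_bigr => i _; set z := x + _.
transitivity (chi (z + m%:R * s) - chi z).
  by rewrite /psi /chi (addrAC z s); ring.
rewrite tele; apply: eq_bigr => j _; rewrite /chi /Delta2.
by rewrite (_ : z + j%:R * s + 2 * s = z + j%:R * s + s + s); ring.
Qed.

Lemma continuous_Delta2 g (t : R) : continuous g -> continuous (Delta2 g t).
Proof.
move=> cg x; apply: cvgD; last exact: cg.
apply: cvgB; first exact: continuous_translate.
by apply: cvgM; [exact: cvg_cst|exact: continuous_translate].
Qed.

Lemma norm1_Delta2_mul g (s : R) (m : nat) : continuous g ->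
  (norm1 (Delta2 g (m%:R * s)) <= (m%:R ^+ 2)%:E * norm1 (Delta2 g s))%E.
Proof.
move=> cg; have cD := @continuous_Delta2 g s cg.
pose H (z : R) := \sum_(j < m) Delta2 g s (z + j%:R * s).
have cH : continuous H.
  apply: (@continuous_sum_ord (fun j z => Delta2 g s (z + j%:R * s))) => j.
  exact: continuous_translate.
apply: (le_trans (@norm1_sum_translate_le _ H m (fun i => i%:R * s) cH _)).
  by move=> x; rewrite Delta2_mul_sum.
rewrite expr2 EFinM -muleA lee_wpmul2l ?lee_fin//.
exact: (@norm1_sum_translate_le _ (Delta2 g s) m (fun i => i%:R * s)).
Qed.

Lemma norm1_Delta2_le_omega2 g (h t : R) : `|t| <= h ->
  (norm1 (Delta2 g t) <= omega2 g h)%E.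
Proof. by move=> th; apply: ereal_sup_ubound; exists t. Qed.

Lemma omega2_ge0 g (h : R) : 0 <= h -> (0 <= omega2 g h)%E.
Proof.
move=> h0; apply: le_trans (norm1_ge0 _) (@norm1_Delta2_le_omega2 g h 0 _).
by rewrite normr0.
Qed.

Lemma norm1_Delta2_scale g (h t : R) : continuous g -> 0 < h -> 0 <= t ->
  (norm1 (Delta2 g t) <= ((1 + t / h) ^+ 2)%:E * omega2 g h)%E.
Proof.
move=> cg h0 t0; have th0 : 0 <= t / h by rewrite divr_ge0// ltW.
(* This m satisfies t/m <= h and m <= 1 + t/h, and it is positive even for t = 0. *)
pose m := (Num.truncn (t / h)).+1.
have m0 : 0 < m%:R :> R by rewrite ltr0n.
have tE : t = m%:R * (t / m%:R) by rewrite mulrC divfK ?gt_eqF.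
rewrite {1}tE; apply: (le_trans (norm1_Delta2_mul _ _ cg)).
have tm : `|t / m%:R| <= h.
  rewrite ger0_norm ?divr_ge0// ler_pdivrMr// -ler_pdivrMl// mulrC.
  exact/ltW/truncnS_gt.
apply: (@le_trans _ _ ((m%:R ^+ 2)%:E * omega2 g h)%E).
  by rewrite lee_wpmul2l ?lee_fin ?sqr_ge0// norm1_Delta2_le_omega2.
apply: lee_wpmul2r; first by rewrite omega2_ge0// ltW.
rewrite lee_fin lerXn2r ?nnegrE ?addr_ge0//.
by rewrite /m -nat1r lerD2l truncn_le.
Qed.

Lemma omega2_le_norm1 g (h : R) : continuous g ->
  (omega2 g h <= 4%:E * norm1 g)%E.
Proof.
move=> cg; apply: ge_ereal_sup => _ [t _ <-].
(* The shifts occurring in [Delta2], with t listed twice for its coefficient 2. *)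
pose a (i : nat) : R := nth 0 [:: 2 * t; t; t; 0] i.
have -> : (4%:E * norm1 g = \int[mu]_x \sum_(i < 4) (`|g (x + a i)|)%:E)%E.
  rewrite ge0_integral_sum//; last first.
    by move=> i; apply: measurable_norm; exact: continuous_translate.
  rewrite (eq_bigr (fun=> norm1 g)); last first.
    by move=> i _; rewrite -(norm1_translate (a i) cg).
  by rewrite sumr_const card_ord mule_natl.
apply: ge0_le_integral_nonmeas => x _; first by rewrite lee_fin.
rewrite sumEFin lee_fin !big_ord_recr big_ord0/= add0r /a/= addr0.
rewrite /Delta2 (le_trans (ler_normD _ _))// lerD2r.
rewrite (le_trans (ler_normB _ _))// -addrA lerD2l normrM ger0_norm//.
by rewrite mulr_natl mulr2n.
Qed.

End modulus.

(** * Integrals against the kernel *)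

Section reflection.
Context {R : realType}.
Notation mu := (@lebesgue_measure R).
Notation Rpos := (`]0%R, +oo[%classic : set R).

Lemma measurable_Rpos : measurable (Rpos : set (measurableTypeR R)).
Proof. exact: measurable_itv. Qed.

Lemma ge0_integral_reflect (h : R -> \bar R) : measurable_fun setT h ->
  (forall x : R, (0 <= h x)%E) ->
  (\int[mu]_(x in `]-oo, 0%R]) h x = \int[mu]_(y in Rpos) h (- y)%R)%E.
Proof.
move=> mh h0.
have mN : measurable_fun setT (fun y : R => h (- y)).
  exact: (measurableT_comp mh (@oppr_measurable R setT)).
rewrite integral_itv_obnd_cbnd; last exact: measurable_funS mN.
rewrite (ge0_integration_by_substitution0 mN)//.
by apply: eq_integral => x _; rewrite opprK.
Qed.

Lemma integral_reflect (h : R -> \bar R) : measurable_fun setT h ->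
  (\int[mu]_(x in `]-oo, 0%R]) h x = \int[mu]_(y in Rpos) h (- y)%R)%E.
Proof.
move=> mh; rewrite integralE [RHS]integralE; congr (_ - _)%E.
  rewrite ge0_integral_reflect; [|exact: measurable_funepos|by []].
  by apply: eq_integral => y _; rewrite !funeposE.
rewrite ge0_integral_reflect; [|exact: measurable_funeneg|by []].
by apply: eq_integral => y _; rewrite !funenegE.
Qed.

Lemma integral_split (h : R -> \bar R) : measurable_fun setT h ->
  (\int[mu]_x h x = \int[mu]_(y in Rpos) h (- y)%R + \int[mu]_(y in Rpos) h y)%E.
Proof.
move=> mh; rewrite -integral_reflect// -integral_setU//.
- by rewrite -setCitvr setvU.
- by rewrite -setCitvr setvU.
- rewrite disj_set2E; apply/eqP; rewrite -subset0 => x /= [].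
  by rewrite !in_itv/= andbT leNgt => /negP.
Qed.

Lemma integral_opp (h : R -> \bar R) : measurable_fun setT h ->
  (\int[mu]_x h (- x)%R = \int[mu]_x h x)%E.
Proof.
move=> mh; rewrite integral_split; last first.
  exact: (measurableT_comp mh (@oppr_measurable R setT)).
rewrite [RHS]integral_split// addeC; congr (_ + _)%E.
by apply: eq_integral => x _; rewrite opprK.
Qed.

(** This symmetrises an integral over the line. Both halves are taken integrable because [fine] is
    additive only on finite values. *)
Lemma Rintegral_split (h : R -> R) : measurable_fun setT h ->
  mu.-integrable Rpos (EFin \o h) ->
  mu.-integrable Rpos (EFin \o (fun y => h (- y))) ->
  Rintegral mu setT h = Rintegral mu Rpos (fun y => h y + h (- y)).
Proof.
move=> mh ih ihN; rewrite RintegralD// /Rintegral.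
rewrite (@integral_split (EFin \o h)); last exact/measurable_EFinP.
rewrite addeC fineD//; first exact: integrable_fin_num ih.
exact: integrable_fin_num ihN.
Qed.

End reflection.

Section kernel.
Context {R : realType} (alpha : nat) (beta xi : R).
Hypothesis alpha_gt0 : (0 < alpha)%N.
Hypothesis xi_gt0 : 0 < xi.
Notation mu := (@lebesgue_measure R).
Notation Rpos := (`]0%R, +oo[%classic : set R).

Definition kden (y : R) : R := (y ^+ (2 * alpha) + xi ^+ (2 * alpha)) `^ beta.

Lemma kden_base_gt0 (y : R) : 0 < y ^+ (2 * alpha) + xi ^+ (2 * alpha).
Proof. by rewrite ltr_wpDl ?exprn_gt0// exprM exprn_ge0// sqr_ge0. Qed.

Lemma kden_gt0 (y : R) : 0 < kden y.
Proof. by rewrite powR_gt0// kden_base_gt0. Qed.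

Lemma kdenN (y : R) : kden (- y) = kden y.
Proof. by rewrite /kden !exprM sqrrN. Qed.

Lemma continuous_div_kden (h : R -> R) : continuous h ->
  continuous (fun y => h y / kden y).
Proof.
move=> ch y; apply: cvgM; first exact: ch.
suff : {for y, continuous (fun z => (kden z)^-1)} by [].
have -> : (fun z => (kden z)^-1) = (fun z => z ^+ 0 / kden z).
  by apply/funext => z; rewrite expr0 mul1r.
by apply: continuous_kernel; exact: kden_base_gt0.
Qed.

(** The half-line moment of order j of the kernel: the Beta integral with p = 2 alpha, q = xi^(2
    alpha), b = beta, in closed form so that its Gamma factors meet those of [Wc]. *)
Definition mom (j : nat) : R :=
  let a := j.+1%:R / (2 * alpha%:R) in
  Gamma a * Gamma (beta - a) / ((2 * alpha)%:R * Gamma beta) *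
  (xi ^+ (2 * alpha)) `^ (- (beta - a)).

Let a2_gt0 : 0 < 2 * alpha%:R :> R.
Proof. by rewrite mulr_gt0// ltr0n. Qed.

Section moment.
Variable j : nat.
Hypothesis jb : j.+1%:R / (2 * alpha%:R) < beta.

Lemma integral_mom : (\int[mu]_(y in Rpos) (y ^+ j / kden y)%:E = (mom j)%:E)%E.
Proof.
apply: integral_moment => //; rewrite ?muln_gt0 ?exprn_gt0//.
by rewrite natrM mulrC divfK// gt_eqF.
Qed.

Lemma integrable_mom : mu.-integrable Rpos (EFin \o (fun y => y ^+ j / kden y)).
Proof.
apply/integrableP; split.
  apply/measurable_EFinP; apply: measurable_funTS; apply: continuous_measurable_fun.
  by apply: continuous_div_kden; exact: exprn_continuous.
rewrite (_ : (\int[mu]_(y in Rpos) _)%E = (mom j)%:E) ?ltry//.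
rewrite -integral_mom; apply: eq_integral => y /RposP y0 /=.
by rewrite ger0_norm// divr_ge0 ?exprn_ge0 ?(ltW y0)// ltW// kden_gt0.
Qed.

Lemma Rintegral_mom : Rintegral mu Rpos (fun y => y ^+ j / kden y) = mom j.
Proof. by rewrite /Rintegral integral_mom. Qed.

(** Gamma(beta) cancels, and alpha against 2 alpha leaves 1/2, the share of one half-line. The
    exponents of xi add up to 2 alpha a - 1 = j. *)
Lemma Wc_mom : Wc alpha beta xi * mom j =
  Gamma (j.+1%:R / (2 * alpha%:R)) * Gamma (beta - j.+1%:R / (2 * alpha%:R)) /
  (Gamma (1 / (2 * alpha%:R)) * Gamma (beta - 1 / (2 * alpha%:R))) / 2 * xi ^+ j.
Proof.
have a0 (k : nat) : 0 < k.+1%:R / (2 * alpha%:R) :> R by rewrite divr_gt0.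
have j1 : 1 / (2 * alpha%:R) < beta.
  apply: le_lt_trans jb; rewrite ler_pdivrMr// divfK ?gt_eqF//.
  by rewrite ler1n.
have Gb := Gamma_gt0 (lt_trans (a0 j) jb).
have Ga := Gamma_gt0 (a0 0%N).
have Gba : 0 < Gamma (beta - 1 / (2 * alpha%:R)) by rewrite Gamma_gt0// subr_gt0.
have al0 : 0 < alpha%:R :> R by rewrite ltr0n.
rewrite /Wc /mom; set a := j.+1%:R / _.
have xj : xi `^ (2 * alpha%:R * beta - 1) * (xi ^+ (2 * alpha)) `^ (- (beta - a))
    = xi ^+ j.
  rewrite -!powR_mulrn ?ltW// -powRrM -powRD; last by rewrite (gt_eqF xi_gt0) implybT.
  have aE : 2 * alpha%:R * a = j.+1%:R by rewrite mulrC divfK ?gt_eqF.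
  by congr (_ `^ _); rewrite natrM -[RHS](addrK 1) natr1 -aE; ring.
rewrite -xj natrM; move: Gb Ga Gba; clear xj; clearbody a.
move: (_ `^ _) (_ `^ (- (beta - a))) (Gamma (beta - a)) (Gamma a) => u v ga gba.
move: (Gamma beta) (Gamma (1 / _)) (Gamma (beta - 1 / _)) => g b0 b1 g0 b00 b10.
by field; rewrite !gt_eqF.
Qed.

End moment.

(** The top degree of [taylor_sum N] is N - 1, whose moment has parameter N / (2 alpha); hence the
    condition on beta. *)
Lemma integrable_taylor_sum (N : nat) (c : nat -> R) :
  (N%:R / (2 * alpha%:R) < beta) ->
  mu.-integrable Rpos (EFin \o (fun y => taylor_sum N c y / kden y)) /\
  Rintegral mu Rpos (fun y => taylor_sum N c y / kden y) =
    \sum_(k < N) c k * (mom k / k`!%:R).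
Proof.
elim: N => [|N IH] Nb.
  have E : (fun y => taylor_sum 0 c y / kden y) = cst 0.
    by apply/funext => y; rewrite /taylor_sum big_ord0 mul0r.
  rewrite E big_ord0; split; first exact: integrable0.
  by rewrite /Rintegral integral0.
have [] := IH.
  by apply: le_lt_trans Nb; rewrite ler_pM2r ?invr_gt0// ler_nat.
move=> i1 e1; have i2 := integrable_mom Nb.
have i3 : mu.-integrable Rpos (EFin \o (fun y => c N / N`!%:R * (y ^+ N / kden y))).
  exact: (integrableZl _ (c N / N`!%:R) i2).
have E y : taylor_sum N.+1 c y / kden y =
    taylor_sum N c y / kden y + c N / N`!%:R * (y ^+ N / kden y).
  by rewrite /taylor_sum big_ord_recr/= mulrDl; congr (_ + _); ring.
split.
  have := integrableD measurable_Rpos i1 i3.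
  by apply: eq_integrable => // y _; rewrite /= -EFinD -E.
rewrite (funext E : (fun y => taylor_sum N.+1 c y / kden y) = _).
rewrite RintegralD// e1 RintegralZl// Rintegral_mom// big_ord_recr/=.
by congr (_ + _); ring.
Qed.

(** The Taylor bound at a fixed point has a constant affine in y, so the moments of orders j and j +
    1 together dominate. *)
Lemma integrable_affine_bound (h : R -> R) (j : nat) (a b : R) :
  j.+2%:R / (2 * alpha%:R) < beta -> continuous h ->
  (forall y : R, 0 < y -> `|h y| <= (a + b * y) * y ^+ j) ->
  mu.-integrable Rpos (EFin \o (fun y => h y / kden y)).
Proof.
move=> jb ch hb.
have jb' : j.+1%:R / (2 * alpha%:R) < beta.
  by apply: le_lt_trans jb; rewrite ler_pM2r ?invr_gt0// ler_nat.
have i1 := integrableZl measurable_Rpos a (integrable_mom jb').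
have i2 := integrableZl measurable_Rpos b (integrable_mom jb).
apply: le_integrable (integrableD measurable_Rpos i1 i2) => //.
  apply/measurable_EFinP; apply: measurable_funTS; apply: continuous_measurable_fun.
  exact: continuous_div_kden.
move=> y /mem_set/RposP y0; rewrite /= lee_fin normrM normfV.
rewrite (gtr0_norm (kden_gt0 y)).
rewrite [leRHS](_ : _ = `|(a + b * y) * y ^+ j| / kden y).
  rewrite ler_pM2r ?invr_gt0 ?kden_gt0//; apply: le_trans (hb _ y0) (ler_norm _).
rewrite exprS -[in RHS](gtr0_norm (kden_gt0 y)) -normfV -normrM.
by congr `|_|; ring.
Qed.

End kernel.

(** * The error of the singular integral *)

Section expansion.
Context {R : realType} (n alpha : nat) (beta : R) (f : R -> R).
Hypothesis n_ge2 : (2 <= n)%N.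
Hypothesis n_even : ~~ odd n.
Hypothesis alpha_gt0 : (0 < alpha)%N.
Hypothesis n3_beta : n.+3%:R / (2 * alpha%:R) < beta.
Hypothesis Cf : Cn n f.
Hypothesis L1f : L1 (derive1n n f).
Notation mu := (@lebesgue_measure R).
Notation Rpos := (`]0%R, +oo[%classic : set R).
Notation g := (derive1n n f).

Let a2_gt0 : 0 < 2 * alpha%:R :> R.
Proof. by rewrite mulr_gt0// ltr0n. Qed.

Let lt_beta (k : nat) : (k <= n.+3)%N -> k%:R / (2 * alpha%:R) < beta.
Proof. by move=> kn; apply: le_lt_trans n3_beta; rewrite ler_pM2r ?invr_gt0// ler_nat. Qed.

Let n_gt0 : (0 < n)%N. Proof. exact: ltn_trans n_ge2. Qed.

Let cg : continuous g. Proof. by case: Cf. Qed.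

Lemma norm1_derive_fin : norm1 g = (fine (norm1 g))%:E.
Proof.
rewrite fineK// ge0_fin_numE ?norm1_ge0//.
by move/integrableP : L1f => [_]; rewrite /norm1.
Qed.

(* k-th derivative of y |-> f (x + e y), for the two directions e = 1 and e = -1. *)
Definition ray (x e : R) (k : nat) (y : R) : R := e ^+ k * derive1n k f (x + e * y).

Lemma is_derive_ray (x e : R) (k : nat) (y : R) : (k < n)%N ->
  is_derive y (1 : R) (ray x e k) (ray x e k.+1 y).
Proof.
move=> kn.
have d1 : is_derive y (1 : R) (fun y : R => x + e * y) e.
  have := is_deriveD (is_derive_cst x y (1 : R)) (is_derive_monomial e 1 y).
  by move=> d; apply: (is_derive_eq d); rewrite add0r expr0 !mulr1.
have d2 (z : R) : is_derive z (1 : R) (derive1n k f) (derive1n k.+1 f z).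
  by apply: DeriveDef; [exact: Cf.1|rewrite derive1nS derive1E].
have := is_deriveZ (e ^+ k) (is_derive1_comp d1 (d2 (x + e * y))).
move=> d; apply: (is_derive_eq d).
by rewrite /ray exprSr /GRing.scale/=; ring.
Qed.

Lemma continuous_ray (x e : R) (k : nat) : (k <= n)%N -> continuous (ray x e k).
Proof.
rewrite leq_eqVlt => /orP[/eqP ->|kn] y; last exact: is_derive_continuous (is_derive_ray _ _ _ kn).
apply: cvgM; first exact: cvg_cst.
apply: (@continuous_comp _ _ _ (fun y : R => x + e * y) g); last exact: cg.
by apply: cvgD; [exact: cvg_cst|apply: cvgM; [exact: cvg_cst|exact: cvg_id]].
Qed.

Lemma norm1_ray (x e : R) : e = 1 \/ e = -1 ->
  (\int[mu]_t (`|ray x e n t|)%:E = norm1 g)%E.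
Proof.
have tr : (\int[mu]_t (`|g (x + t)|)%:E = norm1 g)%E.
  rewrite -(norm1_translate x cg); apply: eq_integral => t _.
  by rewrite addrC.
case=> ->; rewrite -tr.
  by apply: eq_integral => t _; rewrite /ray expr1n !mul1r.
rewrite -[RHS]integral_opp; last first.
  apply: (@measurable_norm R (fun t => g (x + t))).
  by have := @continuous_ray x 1 n (leqnn n); rewrite /ray expr1n; under eq_fun do rewrite !mul1r.
by apply: eq_integral => t _; rewrite /ray normrM normrX normrN1 expr1n mul1r mulN1r.
Qed.

(** The constant [ray x e n 0] has absolute value |g(x)| and costs |g(x)| Y. This crude bound serves
    convergence only; the norm estimate uses the second difference. *)
Lemma integral_ray_le (x e Y : R) : e = 1 \/ e = -1 -> 0 <= Y ->
  (\int[mu]_(t in `[0%R, Y]) (`|ray x e n t - ray x e n 0|)%:E <=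
   (fine (norm1 g) + `|g x| * Y)%:E)%E.
Proof.
move=> e1 Y0.
have en : `|e ^+ n| = 1.
  by rewrite normrX; case: e1 => ->; rewrite ?normrN1 ?normr1 expr1n.
have mr : measurable_fun setT (fun t => (`|ray x e n t|)%:E).
  exact: measurable_norm (@continuous_ray x e n (leqnn n)).
apply: (@le_trans _ _ (\int[mu]_(t in `[0%R, Y]) ((`|ray x e n t|)%:E + (`|g x|)%:E))%E).
  apply: ge0_le_integral_nonmeas => t _; first by rewrite lee_fin.
  rewrite -EFinD lee_fin (le_trans (ler_normB _ _))// lerD2l.
  by rewrite /ray mulr0 addr0 normrM en mul1r.
rewrite ge0_integralD//; last exact: measurable_funS mr.
rewrite EFinD leeD//.
  rewrite -norm1_derive_fin -(norm1_ray x e1); apply: ge0_subset_integral => //.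
rewrite integral_cst//= lebesgue_measure_itv/= lte_fin; case: ltP => [_|Y0'].
  by rewrite oppr0 addr0 EFinM.
by rewrite mule0 lee_fin mulr_ge0.
Qed.

Let c2 (x : R) (k : nat) : R := ray x 1 k 0 + ray x (-1) k 0.

(* The odd coefficients of [c2 x] vanish. *)
Definition remainder (x y : R) : R :=
  ray x 1 0 y + ray x (-1) 0 y - taylor_sum n.+1 (c2 x) y.

Lemma continuous_taylor_sum (N : nat) (c : nat -> R) : continuous (taylor_sum N.+1 c).
Proof. by move=> y; exact: is_derive_continuous (is_derive_taylor_sum N c y). Qed.

(** As n is even, the n-th derivative in y of f(x+y) + f(x-y) is g(x+y) + g(x-y). Subtracting its
    value 2 g(x) at 0 leaves the second difference of step y based at x - y, and [taylor_bound]
    applies with m = n - 1. *)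
Lemma remainder_bound (x y C : R) : 0 < y ->
  (\int[mu]_(t in `[0%R, y]) (`|Delta2 g t (x - t)|)%:E <= C%:E)%E ->
  `|remainder x y| <= C * (y ^+ n.-1 / n.-1`!%:R).
Proof.
move=> y0 hC.
have yy : 0 <= y <= y by rewrite lexx ltW.
have := @taylor_bound R n.-1 (fun k y => ray x 1 k y + ray x (-1) k y) C y.
rewrite prednK//; apply => //.
- move=> k; rewrite -ltnS prednK// => kn z.
  by apply: is_deriveD; exact: is_derive_ray.
- by move=> z; apply: cvgD; exact: continuous_ray.
- apply: le_trans hC; rewrite le_eqVlt; apply/orP; left; apply/eqP.
  apply: eq_integral => t _; congr ((`|_|)%:E).
  rewrite /ray /Delta2 expr1n -signr_odd (negbTE n_even) expr0 !mul1r !mulN1r.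
  rewrite oppr0 addr0 (_ : x - t + 2 * t = x + t); last by ring.
  by rewrite subrK; ring.
Qed.

Section fixed_xi.
Variable xi : R.
Hypothesis xi_gt0 : 0 < xi.

(** The degree n Taylor polynomial is integrated by the moments up to order n, and the rest, having
    an affine constant, by those of orders n - 1 and n. *)
Lemma integrable_ray (x e : R) : e = 1 \/ e = -1 ->
  mu.-integrable Rpos (EFin \o (fun y => ray x e 0 y / kden alpha beta xi y)).
Proof.
move=> e1; pose T := taylor_sum n.+1 (fun k => ray x e k 0).
have [i1 _] := integrable_taylor_sum alpha_gt0 xi_gt0 (fun k => ray x e k 0)
  (lt_beta (leq_trans (leqnSn n.+1) (leqnSn n.+2))).
have i2 : mu.-integrable Rpos (EFin \o (fun y => (ray x e 0 y - T y) / kden alpha beta xi y)).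
  apply: (@integrable_affine_bound R alpha beta xi alpha_gt0 xi_gt0 _ n.-1
    (fine (norm1 g) / n.-1`!%:R) (`|g x| / n.-1`!%:R)).
  - by rewrite prednK//; exact: (lt_beta (leq_trans (leqnSn n.+1) (leqnSn n.+2))).
  - move=> y; apply: cvgB; [exact: continuous_ray|exact: continuous_taylor_sum].
  - move=> y y0.
    have yy : 0 <= y <= y by rewrite lexx ltW.
    have h := @taylor_bound R n.-1 (ray x e) (fine (norm1 g) + `|g x| * y) y.
    rewrite prednK// in h; apply: (le_trans (h _ _ _ y yy)).
    + by move=> k; rewrite -ltnS prednK// => kn z; exact: is_derive_ray.
    + exact: continuous_ray.
    + exact: integral_ray_le e1 (ltW y0).
    + by rewrite le_eqVlt; apply/orP; left; apply/eqP; ring.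
have := integrableD (measurable_Rpos) i1 i2; apply: eq_integrable => // y _.
by rewrite /= -EFinD -mulrDl addrC subrK.
Qed.

Notation kd := (kden alpha beta xi).
Notation W := (Wc alpha beta xi).

Let integrable_c2 (x : R) := integrable_taylor_sum alpha_gt0 xi_gt0 (c2 x)
  (lt_beta (leq_trans (leqnSn n.+1) (leqnSn n.+2))).

Lemma integrable_remainder (x : R) :
  mu.-integrable Rpos (EFin \o (fun y => remainder x y / kd y)).
Proof.
have i1 := integrable_ray x (or_introl (erefl (1 : R))).
have i2 := integrable_ray x (or_intror (erefl (-1 : R))).
have := integrableB measurable_Rpos (integrableD measurable_Rpos i1 i2) (integrable_c2 x).1.
by apply: eq_integrable => // y _; rewrite /remainder/= mulrBl mulrDl.
Qed.

(** The factor 1 + (-1)^k, carried by [c2], kills odd k and doubles even k. The term k = 0 is set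
    apart because it becomes f(x). *)
Lemma even_part_sum (F : nat -> R) (m : nat) :
  \sum_(k < (2 * m).+1%N) (1 + (-1) ^+ k) * F k =
  2 * F 0%N + \sum_(1 <= rho < m.+1) 2 * F (2 * rho)%N.
Proof.
elim: m => [|m IH].
  by rewrite big_ord_recr big_ord0/= big_geq// addr0 add0r expr0.
rewrite mulnS !addSn add0n big_ord_recr big_ord_recr/= IH [in RHS]big_nat_recr//=.
rewrite mulnS !addSn add0n !exprS exprM sqrrN expr1n expr1n; ring.
Qed.

Lemma c2E (x : R) (k : nat) : c2 x k = (1 + (-1) ^+ k) * derive1n k f x.
Proof. by rewrite /c2 /ray expr1n !mulr0 addr0 mulrDl. Qed.

Lemma MxiE (x : R) : Mxi alpha beta xi f x =
  W * Rintegral mu Rpos (fun y => remainder x y / kd y) +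
  W * \sum_(k < n.+1) c2 x k * (mom alpha beta xi k / k`!%:R).
Proof.
have [i3 e3] := integrable_c2 x.
rewrite -mulrDr -e3 -RintegralD//; last exact: integrable_remainder.
congr (_ * _).
have E e y : ray x e 0 y = f (x + e * y) by rewrite /ray expr0 mul1r.
have i1 := integrable_ray x (or_introl (erefl (1 : R))).
have i2 := integrable_ray x (or_intror (erefl (-1 : R))).
rewrite (@Rintegral_split R (fun y => f (x + y) / kd y)).
- apply: eq_Rintegral => y _.
  rewrite kdenN /remainder !E mul1r mulN1r -!mulrDl; congr (_ / _).
  by rewrite subrK.
- apply: continuous_measurable_fun; apply: continuous_div_kden => //.
  have -> : (fun y => f (x + y)) = ray x 1 0.
    by apply/funext => y; rewrite E mul1r.
  exact: continuous_ray.
- by apply: eq_integrable i1 => // y _; rewrite /= E mul1r.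
- by apply: eq_integrable i2 => // y _; rewrite /= E mulN1r kdenN.
Qed.

Lemma Wc_moment (j : nat) : (j <= n.+2)%N -> W * mom alpha beta xi j =
  Gamma (j.+1%:R / (2 * alpha%:R)) * Gamma (beta - j.+1%:R / (2 * alpha%:R)) /
  (Gamma (1 / (2 * alpha%:R)) * Gamma (beta - 1 / (2 * alpha%:R))) / 2 * xi ^+ j.
Proof. by move=> jn; apply: Wc_mom => //; exact: lt_beta. Qed.

Let gamma_norm_neq0 :
  Gamma (1 / (2 * alpha%:R)) * Gamma (beta - 1 / (2 * alpha%:R)) != 0 :> R.
Proof.
have b1 := lt_beta (isT : (1 <= n.+3)%N).
by rewrite mulf_neq0// gt_eqF// Gamma_gt0// ?subr_gt0// divr_gt0.
Qed.

Lemma KfunE (x : R) : Kfun n alpha beta xi f x =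
  W * Rintegral mu Rpos (fun y => remainder x y / kd y).
Proof.
rewrite /Kfun MxiE -!addrA [X in _ + X](_ : _ = 0) ?addr0//.
apply/eqP; rewrite -opprD subr_eq0; apply/eqP.
rewrite mulr_sumr.
pose F (k : nat) := derive1n k f x / k`!%:R * (W * mom alpha beta xi k).
transitivity (\sum_(k < n.+1) (1 + (-1) ^+ k) * F k).
  by apply: eq_bigr => k _; rewrite c2E /F; ring.
have nE : n = (2 * n./2)%N by rewrite mul2n even_halfK.
have -> : \sum_(k < n.+1) (1 + (-1) ^+ k) * F k =
    \sum_(k < (2 * n./2).+1%N) (1 + (-1) ^+ k) * F k by rewrite -nE.
rewrite even_part_sum; congr (_ + _).
  (* [Wc] is normalised so that W times the moment of order 0 is 1/2; twice the term k = 0 is then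
     exactly f(x). *)
  rewrite /F Wc_moment// divff// fact0 expr0 derive1n0.
  by field.
apply: eq_big_nat => rho /andP[_ rhon]; rewrite /F Wc_moment; last first.
  by rewrite (leq_trans _ (leq_trans (leqnSn n) (leqnSn n.+1)))// nE leq_mul2l -ltnS rhon.
have half (u v : R) : 2 * (u / 2 * v) = u * v by field.
by rewrite mulrCA half !mulrA.
Qed.

(** * Domination of K and integration in x *)

Let continuous_power_kden (j : nat) : continuous (fun y : R => y ^+ j / kd y).
Proof. by apply: continuous_div_kden => //; exact: exprn_continuous. Qed.

Lemma Wc_ge0 : 0 <= W.
Proof.
have b1 := lt_beta (isT : (1 <= n.+3)%N).
have b0 : 0 < beta by apply: le_lt_trans b1; rewrite divr_ge0// ltW.
have a1 : 0 < 1 / (2 * alpha%:R) :> R by rewrite divr_gt0.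
have ba1 : 0 < beta - 1 / (2 * alpha%:R) by rewrite subr_gt0.
rewrite divr_ge0 ?mulr_ge0 ?powR_ge0 ?ler0n//; apply: ltW; exact: Gamma_gt0.
Qed.

Definition Delta_mass (x y : R) : \bar R :=
  (\int[mu]_(t in `[0%R, y]) (`|Delta2 g t (x - t)|)%:E)%E.

Definition weight (y : R) : R := (n.-1)`!%:R^-1 * (y ^+ n.-1 / kd y).

(* An integrable majorant of |K| which, unlike K itself, is visibly measurable. *)
Definition majorant (x : R) : \bar R :=
  (W%:E * \int[mu]_(y in Rpos) ((weight y)%:E * Delta_mass x y))%E.

Lemma Delta_mass_ge0 (x y : R) : (0 <= Delta_mass x y)%E.
Proof. by apply: integral_ge0 => t _; rewrite lee_fin. Qed.

Lemma weight_gt0 (y : R) : 0 < y -> 0 < weight y.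
Proof.
move=> y0; rewrite mulr_gt0 ?invr_gt0 ?ltr0n ?fact_gt0// divr_gt0 ?exprn_gt0//.
exact: kden_gt0.
Qed.

Lemma continuous_weight : continuous weight.
Proof.
move=> y; apply: cvgM; first exact: cvg_cst.
exact: continuous_power_kden.
Qed.

Lemma abs_Kfun_le (x : R) : ((`|Kfun n alpha beta xi f x|)%:E <= majorant x)%E.
Proof.
rewrite KfunE normrM (ger0_norm Wc_ge0) EFinM.
apply: lee_wpmul2l; first by rewrite lee_fin Wc_ge0.
have ir := integrable_remainder x.
rewrite EFin_normr_Rintegral//.
apply: (le_trans (le_abse_integral _ _ _)).
- exact: measurable_Rpos.
- by case/integrableP : ir.
apply: ge0_le_integral_nonmeas => y; first by rewrite abse_ge0.
move=> /mem_set/RposP y0; rewrite /= normrM normfV (gtr0_norm (kden_gt0 _ _ _ _))//.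
have := @remainder_bound x y; rewrite -/(Delta_mass x y).
have := Delta_mass_ge0 x y.
(* An infinite mass is harmless: the weight is positive, so the right-hand side is infinite too. *)
case: (Delta_mass x y) => [C C0|_ _|//]; last first.
  by rewrite gt0_muley ?leey// lte_fin weight_gt0.
move=> /(_ C y0 (lexx _)) h.
rewrite -EFinM lee_fin /weight [leRHS](_ : _ = C * (y ^+ n.-1 / n.-1`!%:R) / kd y).
  by rewrite ler_pM2r// invr_gt0 kden_gt0.
ring.
Qed.

(** The points ((x, y), t) with 0 <= t <= y. Cutting by this set turns the variable endpoint of
    [Delta_mass] into an integral over all t, whose joint measurability in (x, y) Tonelli
    provides. *)
Let band : set ((R * R) * R) :=
  [set z | 0 <= z.2] `&` [set z | 0 <= z.1.2 - z.2].

Let measurable_band : measurable band.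
Proof.
apply: measurableI.
  rewrite (_ : mkset _ = snd @^-1` `[0, +oo[); last first.
    by apply/seteqP; split => z /=; rewrite in_itv/= andbT.
  rewrite -[X in measurable X]setTI; apply: measurable_snd => //.
rewrite (_ : mkset _ = (fun z : (R * R) * R => z.1.2 - z.2) @^-1` `[0, +oo[); last first.
  by apply/seteqP; split => z /=; rewrite in_itv/= andbT.
rewrite -[X in measurable X]setTI.
have mB : measurable_fun setT (fun z : (R * R) * R => z.1.2 - z.2).
  apply: measurable_funB; last exact: measurable_snd.
  exact: measurableT_comp measurable_snd measurable_fst.
exact: mB.
Qed.

Let mg : measurable_fun setT g.
Proof. exact: continuous_measurable_fun. Qed.

Lemma measurable_Delta2_pair d (T : measurableType d) (u v : T -> R) :
  measurable_fun setT u -> measurable_fun setT v ->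
  measurable_fun setT (fun z => (`|Delta2 g (v z) (u z - v z)|)%:E).
Proof.
move=> mu_ mv; apply/measurable_EFinP.
have mN : measurable_fun setT (fun z => u z - v z) by apply: measurable_funB.
apply: (measurableT_comp (@normr_measurable R setT)).
apply: measurable_funD; last exact: (measurableT_comp mg mN).
apply: measurable_funB.
  apply: (measurableT_comp mg); apply: measurable_funD => //.
  by apply: measurable_funM.
apply: measurable_funM => //.
by apply: (measurableT_comp mg); apply: measurable_funD.
Qed.

Lemma measurable_Delta_mass :
  measurable_fun setT (fun z : R * R => Delta_mass z.1 z.2).
Proof.
pose D (z : (R * R) * R) : \bar R := (`|Delta2 g z.2 (z.1.1 - z.2)|)%:E.
have mD : measurable_fun setT D.
  apply: measurable_Delta2_pair; last exact: measurable_snd.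
  exact: measurableT_comp measurable_fst measurable_fst.
pose P := D \_ band.
have mP : measurable_fun setT P.
  by apply/(measurable_restrictT _ _).1 => //; exact: measurable_funS mD.
have P0 z : (0 <= P z)%E by apply: erestrict_ge0 => u _; rewrite lee_fin.
have := @measurable_fun_fubini_tonelli_F _ _ _ _ R mu P mP P0.
apply: eq_measurable_fun => -[x y] _.
rewrite /fubini_F /Delta_mass [RHS]integral_mkcond; apply: eq_integral => t _.
rewrite /P !patchE/=; congr (if _ then _ else _).
apply/idP/idP => /set_mem/=.
  by move=> [/= t0 ty]; apply: mem_set; rewrite /= in_itv/= t0 -subr_ge0.
rewrite in_itv/= => /andP[t0 ty]; apply: mem_set.
by split => //=; rewrite subr_ge0.
Qed.

Let J (z : R * R) : \bar R := ((weight z.2)%:E * Delta_mass z.1 z.2)%E.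

Let measurable_J : measurable_fun setT J.
Proof.
apply: emeasurable_funM; last exact: measurable_Delta_mass.
apply/measurable_EFinP; apply: (measurableT_comp _ measurable_snd).
exact: continuous_measurable_fun continuous_weight.
Qed.

Let J_ge0 (x y : R) : Rpos y -> (0 <= J (x, y))%E.
Proof.
move=> /mem_set/RposP y0; apply: mule_ge0; last exact: Delta_mass_ge0.
by rewrite lee_fin ltW// weight_gt0.
Qed.

Lemma measurable_majorant : measurable_fun setT majorant.
Proof.
apply: measurable_funeM.
by apply: (@measurable_fun_tonelli_on R _ _ _ _ mu Rpos J) => //; exact: measurable_itv.
Qed.

Lemma integral_Delta_mass (y : R) :
  (\int[mu]_x Delta_mass x y = \int[mu]_(t in `[0%R, y]) norm1 (Delta2 g t))%E.
Proof.
pose D (z : R * R) : \bar R := (`|Delta2 g z.2 (z.1 - z.2)|)%:E.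
have mD : measurable_fun setT D.
  by apply: measurable_Delta2_pair; [exact: measurable_fst|exact: measurable_snd].
transitivity (\int[mu]_(t in `[0%R, y]) \int[mu]_x D (x, t))%E.
  apply: (@tonelli_on R _ _ _ _ mu mu setT `[0%R, y]%classic D) => //.
  by move=> x t _ _; rewrite lee_fin.
apply: eq_integral => t _.
by rewrite -(norm1_translate (- t) (@continuous_Delta2 R g t cg)).
Qed.

Lemma omega2_fin : omega2 g xi = (fine (omega2 g xi))%:E.
Proof.
rewrite fineK// ge0_fin_numE ?omega2_ge0 ?ltW//.
by apply: le_lt_trans (omega2_le_norm1 _ cg) _; rewrite norm1_derive_fin -EFinM ltry.
Qed.

Let om := fine (omega2 g xi).

Let om_ge0 : 0 <= om. Proof. by rewrite fine_ge0// omega2_ge0// ltW. Qed.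

Lemma integral_modulus_le (y : R) : 0 < y ->
  (\int[mu]_(t in `[0%R, y]) norm1 (Delta2 g t) <=
   (om * y ^+ 1 + om / xi * y ^+ 2 + om / (3 * xi ^+ 2) * y ^+ 3)%:E)%E.
Proof.
move=> y0.
(* The primitive of [h] vanishing at 0, written in monomials, [t ^+ 1] included, so that
   [is_derive_monomial] differentiates it termwise. *)
pose F (t : R) := om * t ^+ 1 + om / xi * t ^+ 2 + om / (3 * xi ^+ 2) * t ^+ 3.
pose h (t : R) := (1 + t / xi) ^+ 2 * om.
have dF (t : R) : is_derive t (1 : R) F (h t).
  have := is_deriveD (is_deriveD (is_derive_monomial om 1 t)
    (is_derive_monomial (om / xi) 2 t)) (is_derive_monomial (om / (3 * xi ^+ 2)) 3 t).
  move=> d; apply: (is_derive_eq d); rewrite /h/=; field.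
  by rewrite gt_eqF.
have ch : continuous h.
  move=> t; apply: cvgM; last exact: cvg_cst.
  apply: (@continuous_comp _ _ _ (fun t : R => 1 + t / xi) (fun z : R => z ^+ 2)).
    by apply: cvgD; [exact: cvg_cst|apply: cvgM; [exact: cvg_id|exact: cvg_cst]].
  exact: exprn_continuous.
have cF : continuous F by move=> t; exact: is_derive_continuous (dF t).
apply: (@le_trans _ _ (\int[mu]_(t in `[0%R, y]) (h t)%:E)%E).
  apply: ge0_le_integral_nonmeas => t; first by rewrite norm1_ge0.
  rewrite /= in_itv/= => /andP[t0 _].
  by rewrite EFinM -omega2_fin; exact: norm1_Delta2_scale.
rewrite (@continuous_FTC2 _ h F)//.
- by rewrite {2}/F !expr0n/= !mulr0 !addr0 sube0.
- exact: continuous_subspaceT.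
- split.
  + by move=> t _; case: (dF t).
  + by apply: cvg_at_right_filter; exact: cF.
  + by apply: cvg_at_left_filter; exact: cF.
- by move=> t _; rewrite derive1E; have [_ ->] := dF t.
Qed.

Lemma integral_scaled_moment (c : R) (j : nat) : 0 <= c -> (j <= n.+2)%N ->
  (\int[mu]_(y in Rpos) (c * (y ^+ j / kd y))%:E = (c * mom alpha beta xi j)%:E)%E.
Proof.
move=> c0 jn; under eq_integral => y _ do rewrite EFinM.
rewrite ge0_integralZl_EFin//.
- by rewrite integral_mom//; exact: lt_beta.
- move=> y /mem_set/RposP y0.
  by rewrite lee_fin divr_ge0 ?exprn_ge0 ?(ltW y0)// ltW// kden_gt0.
- apply: measurable_fun_Rpos => y _.
  exact: continuous_power_kden.
Qed.

(** Here c0 is W, o the modulus, x = xi, X = xi^n, w = (n-1)!, u and v the normalising Gamma values,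
    and m0, m1, m2 the moments of orders n, n+1, n+2. The 1/2 of each moment and the 1/3 of the
    cubic term produce the 1/6 of [Cconst]. *)
Lemma moment_algebra (a b c u v w o x X c0 m0 m1 m2 : R) :
  u != 0 -> v != 0 -> x != 0 -> w != 0 ->
  c0 * m0 = a / (u * v) / 2 * X -> c0 * m1 = b / (u * v) / 2 * (x * X) ->
  c0 * m2 = c / (u * v) / 2 * (x * (x * X)) ->
  (3 * a + 3 * b + c) / (6 * u * v * w) * o * X =
  c0 * (w^-1 * o * m0 + w^-1 * (o / x) * m1 + w^-1 * (o / (3 * x ^+ 2)) * m2).
Proof.
move=> u0 v0 x0 w0 h0 h1 h2.
rewrite !mulrDr !(mulrCA c0) h0 h1 h2; field.
by rewrite u0 v0 x0 w0.
Qed.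

Lemma Cconst_moments : Cconst n alpha beta * om * xi ^+ n =
  W * ((n.-1)`!%:R^-1 * om * mom alpha beta xi n +
       (n.-1)`!%:R^-1 * (om / xi) * mom alpha beta xi n.+1 +
       (n.-1)`!%:R^-1 * (om / (3 * xi ^+ 2)) * mom alpha beta xi n.+2).
Proof.
have := gamma_norm_neq0; rewrite mulf_eq0 negb_or => /andP[u0 v0].
apply: moment_algebra.
- exact: u0.
- exact: v0.
- by rewrite gt_eqF.
- by rewrite pnatr_eq0 -lt0n fact_gt0.
- exact: Wc_moment (leq_trans (leqnSn n) (leqnSn n.+1)).
- by rewrite -exprS; exact: Wc_moment (leqnSn n.+1).
- by rewrite -!exprS; exact: Wc_moment (leqnn n.+2).
Qed.

Lemma integral_majorant_le :
  (\int[mu]_x majorant x <= (Cconst n alpha beta * om * xi ^+ n)%:E)%E.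
Proof.
rewrite /majorant ge0_integralZl_EFin ?Wc_ge0//; last 2 first.
- by move=> x _; apply: integral_ge0 => y; exact: (J_ge0 x).
- by apply: (@measurable_fun_tonelli_on R _ _ _ _ mu Rpos J) => //; exact: measurable_itv.
rewrite Cconst_moments [leRHS]EFinM; apply: lee_wpmul2l; first by rewrite lee_fin Wc_ge0.
(* This exchanges x and y; the exchange of x and t is the one in [integral_Delta_mass]. *)
have -> : (\int[mu]_x \int[mu]_(y in Rpos) ((weight y)%:E * Delta_mass x y) =
           \int[mu]_(y in Rpos) \int[mu]_x J (x, y))%E.
  apply: (@tonelli_on R _ _ _ _ mu mu setT Rpos J) => //.
  by move=> x y _; exact: J_ge0.
pose i0 : R := (n.-1)`!%:R^-1.
have i00 : 0 <= i0 by rewrite invr_ge0.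
pose h (c : R) (j : nat) (y : R) : \bar R := (c * (y ^+ j / kd y))%:E.
have h0 c j y : 0 <= c -> Rpos y -> (0 <= h c j y)%E.
  move=> c0 /mem_set/RposP y0.
  by rewrite lee_fin mulr_ge0// divr_ge0 ?exprn_ge0 ?(ltW y0)// ltW// kden_gt0.
have mh c j : measurable_fun Rpos (h c j).
  apply: measurable_fun_Rpos => y _; apply: cvgM; first exact: cvg_cst.
  exact: continuous_power_kden.
have c1 : 0 <= i0 * om by rewrite mulr_ge0.
have c2_ge0 : 0 <= i0 * (om / xi) by rewrite mulr_ge0// divr_ge0// ltW.
have c3 : 0 <= i0 * (om / (3 * xi ^+ 2)).
  by rewrite mulr_ge0// divr_ge0// mulr_ge0// sqr_ge0.
apply: (@le_trans _ _ (\int[mu]_(y in Rpos) (h (i0 * om)%R n y +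
    h (i0 * (om / xi))%R n.+1 y + h (i0 * (om / (3 * xi ^+ 2)))%R n.+2 y))%E).
  apply: ge0_le_integral_nonmeas => y yR.
    by apply: integral_ge0 => x _; exact: J_ge0.
  have y0 : 0 < y by exact: RposP (mem_set yR).
  rewrite /J/= ge0_integralZl_EFin ?(ltW (weight_gt0 y0))//; last 2 first.
  - by move=> x _; exact: Delta_mass_ge0.
  - exact: (measurableT_comp measurable_Delta_mass (pair2_measurable y)).
  rewrite integral_Delta_mass.
  apply: (le_trans (lee_wpmul2l _ (integral_modulus_le y0))).
    by rewrite lee_fin ltW// weight_gt0.
  rewrite -!EFinD -EFinM lee_fin /weight -/i0 -(prednK n_gt0) /= !exprS.
  rewrite le_eqVlt; apply/orP; left; apply/eqP.
  ring.
rewrite ge0_integralD//.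
- rewrite ge0_integralD//.
  + by rewrite /h !integral_scaled_moment// ?leqnSn// ltnW.
  + by move=> y yR; exact: h0.
  + exact: mh.
  + by move=> y yR; exact: h0.
  + exact: mh.
- by move=> y yR; rewrite adde_ge0// h0.
- by apply: emeasurable_funD; exact: mh.
- by move=> y yR; exact: h0.
- exact: mh.
Qed.

Lemma norm1_Kfun_le :
  (norm1 (Kfun n alpha beta xi f) <= (Cconst n alpha beta * om * xi ^+ n)%:E)%E.
Proof.
apply: le_trans integral_majorant_le; apply: ge0_le_integral_nonmeas => x _.
  by rewrite lee_fin.
exact: abs_Kfun_le.
Qed.

End fixed_xi.

(** * Limits as xi tends to 0 from the right *)

Lemma Cconst_ge0 : 0 <= Cconst n alpha beta.
Proof.
have G0 (k : nat) : (k < n.+3)%N -> 0 <= Gamma (k.+1%:R / (2 * alpha%:R)) *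
    Gamma (beta - k.+1%:R / (2 * alpha%:R)) :> R.
  move=> kn; apply: mulr_ge0; apply/ltW/Gamma_gt0; first by rewrite divr_gt0.
  by rewrite subr_gt0; exact: lt_beta.
have G1 := G0 0%N isT.
rewrite /Cconst divr_ge0//; last by rewrite mulr_ge0// -mulrA mulr_ge0.
apply: addr_ge0; last exact: (G0 _ (ltnSn n.+2)).
have ge3 : 0 <= 3 :> R by [].
exact: (addr_ge0 (mulr_ge0 ge3 (G0 n (leqW (leqnSn n.+1))))
  (mulr_ge0 ge3 (G0 n.+1 (leqnSn n.+2)))).
Qed.

(** Bounding the modulus by 4 ||g||_1, independent of xi, leaves xi^n as the only varying factor.
    The bound concerns the majorant because the last limit adds it to other measurable terms. *)
Lemma integral_majorant_le_norm1 (xi : R) : 0 < xi ->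
  (\int[mu]_x majorant xi x <=
   (Cconst n alpha beta * (4 * fine (norm1 g)) * xi ^+ n)%:E)%E.
Proof.
move=> xi0; apply: le_trans (integral_majorant_le xi0) _.
rewrite lee_fin ler_pM2r ?exprn_gt0// ler_wpM2l ?Cconst_ge0//.
by rewrite -lee_fin -omega2_fin// EFinM -norm1_derive_fin; exact: omega2_le_norm1.
Qed.

Lemma squeeze_norm1_cvg0 (F : R -> R -> R) (b : R -> R) :
  (forall xi : R, 0 < xi -> (norm1 (F xi) <= (b xi)%:E)%E) ->
  b xi @[xi --> 0] --> 0 -> norm1 (F xi) @[xi --> 0^'+] --> 0%E.
Proof.
move=> Fb b0; apply: (@squeeze_cvge _ _ _ _ (cst 0%E) _ (EFin \o b)).
- by apply: filterS (nbhs_right_gt (0 : R)) => xi xi0; rewrite norm1_ge0/= Fb.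
- exact: cvg_cst.
- apply: cvg_EFin; first exact: nearW.
  exact: cvg_within_filter.
Qed.

Lemma cvg_monomial0 (c : R) (k : nat) : (0 < k)%N -> c * xi ^+ k @[xi --> 0] --> 0.
Proof.
move=> k0; have : {for (0 : R), continuous (fun xi : R => c * xi ^+ k)}.
  by apply: cvgM; [exact: cvg_cst|exact: exprn_continuous].
by rewrite /prop_for /continuous_at expr0n (gtn_eqF k0) mulr0.
Qed.

Lemma cvgD0 (u v : R -> R) : u xi @[xi --> 0] --> 0 -> v xi @[xi --> 0] --> 0 ->
  u xi + v xi @[xi --> 0] --> 0.
Proof. by move=> u0 v0; have := cvgD u0 v0; rewrite addr0; exact. Qed.

Lemma cvg_norm1_Kfun :
  (fun xi : R => norm1 (Kfun n alpha beta xi f)) @ 0^'+ --> 0%E.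
Proof.
apply: (@squeeze_norm1_cvg0 (fun xi => Kfun n alpha beta xi f)
  (fun xi => Cconst n alpha beta * (4 * fine (norm1 g)) * xi ^+ n)).
  move=> xi xi0; apply: le_trans (integral_majorant_le_norm1 xi0).
  by apply: ge0_le_integral_nonmeas => x _; [rewrite lee_fin|exact: abs_Kfun_le].
exact: cvg_monomial0.
Qed.

(** The factor of f^(k)(x) xi^k, for k = 2 rho, in the sum subtracted in K. *)
Let ratio (k : nat) : R := (k`!)%:R^-1 *
  (Gamma (k.+1%:R / (2 * alpha%:R)) * Gamma (beta - k.+1%:R / (2 * alpha%:R))) /
  (Gamma (1 / (2 * alpha%:R)) * Gamma (beta - 1 / (2 * alpha%:R))).

(** M f - f is K plus the subtracted sum. Replacing |K| by its majorant before integrating makes all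
    summands measurable, so that the integral is additive. *)
Lemma norm1_Mxi_sub_le (xi : R) : 0 < xi ->
  (forall m : nat, (1 <= m <= n./2)%N -> L1 (derive1n (2 * m) f)) ->
  (norm1 (fun x => Mxi alpha beta xi f x - f x)%R <=
   (Cconst n alpha beta * (4 * fine (norm1 g)) * xi ^+ n +
    \sum_(1 <= rho < (n./2).+1)
      fine (norm1 (derive1n (2 * rho) f)) * `|ratio (2 * rho)| * xi ^+ (2 * rho))%:E)%E.
Proof.
move=> xi0 L1m.
pose G (rho : nat) (x : R) : \bar R :=
  ((`|ratio (2 * rho)| * xi ^+ (2 * rho)) * `|derive1n (2 * rho) f x|)%:E.
have c0 (rho : nat) : 0 <= `|ratio (2 * rho)| * xi ^+ (2 * rho).
  by rewrite mulr_ge0// exprn_ge0// ltW.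
have G0 rho x : (0 <= G rho x)%E by rewrite lee_fin mulr_ge0.
have mD rho : (1 <= rho <= n./2)%N ->
    measurable_fun setT (fun x => (`|derive1n (2 * rho) f x|)%:E).
  move=> /L1m/integrableP[/measurable_EFinP mf _].
  by apply/measurable_EFinP; apply: measurableT_comp mf.
have intG rho : (1 <= rho <= n./2)%N -> (\int[mu]_x G rho x =
    (fine (norm1 (derive1n (2 * rho) f)) * `|ratio (2 * rho)| * xi ^+ (2 * rho))%:E)%E.
  move=> rhon; rewrite /G; under eq_integral => x _ do rewrite EFinM.
  rewrite ge0_integralZl_EFin//; last exact: mD.
  rewrite [RHS](_ : _ = ((`|ratio (2 * rho)| * xi ^+ (2 * rho))%:E *
    (fine (norm1 (derive1n (2 * rho) f)))%:E)%E); last first.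
    by rewrite -EFinM; congr EFin; ring.
  congr (_ * _)%E; rewrite fineK//.
  rewrite ge0_fin_numE ?norm1_ge0//.
  by case/integrableP : (L1m _ rhon).
(* The terms are set to 0 outside 1 <= rho <= n/2: additivity over a finite sum asks measurability
   at every index, and only these derivatives are known to be measurable. *)
pose G' rho := if (1 <= rho <= n./2)%N then G rho else cst 0%E.
have GG' x : (\sum_(1 <= rho < (n./2).+1) G rho x =
    \sum_(1 <= rho < (n./2).+1) G' rho x)%E.
  by apply: eq_big_nat => rho; rewrite ltnS /G' => ->.
have mG' rho : measurable_fun setT (G' rho).
  rewrite /G'; case: ifP => // rhon.
  by apply: eq_measurable_fun (measurable_funeM (_ * _)%:E (mD _ rhon)) => x _.
have G'0 rho x : (0 <= G' rho x)%E by rewrite /G'; case: ifP => // _; exact: G0.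
apply: (@le_trans _ _ (\int[mu]_x (majorant xi x + \sum_(1 <= rho < (n./2).+1) G' rho x))%E).
  apply: ge0_le_integral_nonmeas => x _; first by rewrite lee_fin.
  rewrite -GG'; apply: (@le_trans _ _ ((`|Kfun n alpha beta xi f x|)%:E +
    \sum_(1 <= rho < (n./2).+1) G rho x)%E); last first.
    by apply: leeD => //; exact: abs_Kfun_le.
  rewrite sumEFin -EFinD lee_fin /Kfun; set S := \sum_(1 <= rho < _) (_ * _).
  rewrite -{1}(subrK S (Mxi _ _ _ _ _ - _)).
  apply: (le_trans (ler_normD _ _)); rewrite lerD2l.
  apply: (le_trans (ler_norm_sum _ _ _)); apply: ler_sum => rho _.
  rewrite le_eqVlt; apply/orP; left; apply/eqP.
  rewrite -[xi ^+ _ in RHS](ger0_norm (exprn_ge0 _ (ltW xi0))) -!normrM.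
  by congr `|_|; rewrite /ratio; ring.
rewrite ge0_integralD//.
- rewrite EFinD leeD ?integral_majorant_le_norm1// ge0_integral_sum//.
  rewrite -sumEFin le_eqVlt; apply/orP; left; apply/eqP.
  by apply: eq_big_nat => rho; rewrite ltnS => rhon; rewrite /G' rhon intG.
- by move=> x _; apply: le_trans (abs_Kfun_le xi0 x); rewrite lee_fin.
- exact: measurable_majorant.
- by move=> x _; apply: sume_ge0.
- exact: emeasurable_sum.
Qed.

Lemma cvg_norm1_Mxi_sub :
  (forall m : nat, (1 <= m <= n./2)%N -> L1 (derive1n (2 * m) f)) ->
  (fun xi : R => norm1 (fun x => Mxi alpha beta xi f x - f x)) @ 0^'+ --> 0%E.
Proof.
move=> L1m; apply: (@squeeze_norm1_cvg0 (fun xi x => Mxi alpha beta xi f x - f x) _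
  (fun xi xi0 => norm1_Mxi_sub_le xi0 L1m)).
apply: cvgD0; first exact: cvg_monomial0.
elim: n./2 => [|m IH].
  have -> : (fun xi : R => \sum_(1 <= rho < 1)
      fine (norm1 (derive1n (2 * rho) f)) * `|ratio (2 * rho)| * xi ^+ (2 * rho)) = cst 0.
    by apply/funext => xi; rewrite big_geq.
  exact: cvg_cst.
under eq_fun do rewrite big_nat_recr//=.
apply: cvgD0; first exact: IH.
exact: cvg_monomial0.
Qed.

End expansion.

Theorem theorem4 (R : realType) (n alpha : nat) (beta : R) (f : R -> R) :
  (2 <= n)%N -> ~~ odd n -> (0 < alpha)%N ->
  n.+3%:R / (2 * alpha%:R) < beta ->
  Cn n f -> L1 (derive1n n f) ->
  [/\ (forall xi : R, 0 < xi ->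
         (norm1 (Kfun n alpha beta xi f) <=
          (Cconst n alpha beta)%:E * omega2 (derive1n n f) xi * (xi ^+ n)%:E)%E),
      (fun xi : R => norm1 (Kfun n alpha beta xi f)) @ 0^'+ --> 0%E
    & (forall m : nat, (1 <= m <= n./2)%N -> L1 (derive1n (2 * m) f)) ->
      (fun xi : R => norm1 (fun x => Mxi alpha beta xi f x - f x)) @ 0^'+ --> 0%E].
Proof.
move=> n2 ne al nb Cf L1f; split.
- move=> xi xi0; rewrite omega2_fin// -!EFinM; exact: norm1_Kfun_le.
- exact: cvg_norm1_Kfun.
- exact: cvg_norm1_Mxi_sub.
Qed.
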